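(* The following two statements are equivalent. (B) For every 3-connected planar graph $H$ whose vertices are each designated positive or negative, with an even number of negative vertices, there exists a weak signed edge-labeling of $H$. (C) For every 3-connected planar graph $H$ whose vertices are each designated positive or negative, with an even number of negative vertices, there exists a strong signed edge-labeling of $H$.
   Context: Let $H$ be a graph whose vertices are each designated positive or negative. For a labeling $c:E(H)\to\{0,a,b\}$ and $x\in\{0,a,b\}$, let $d_x(v)$ be the number of edges incident to $v$ labeled $x$, and let $d_H(v)$ be the degree of $v$. The labeling $c$ is a weak signed edge-labeling of $H$ if for every vertex $v$: $d_0(v)\equiv d_H(v)\pmod 2$; and $d_a(v)\equiv d_b(v)\equiv d_H(v)\pmod 2$ if $v$ is positive, while $d_a(v)\equiv d_b(v)\equiv d_H(v)+1\pmod 2$ if $v$ is negative. A strong signed edge-labeling of $H$ is a weak signed edge-labeling $c$ of $H$ such that additionally $d_0(v)<d_H(v)$ for every vertex $v$ of odd degree. *)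

(* Defs.v *)
From HB Require Import structures.
From mathcomp Require Import all_boot all_order all_algebra.
From mathcomp Require Import all_classical all_reals all_analysis.
Import Order.TTheory GRing.Theory Num.Theory.
Import numFieldNormedType.Exports.
Set Implicit Arguments.
Unset Strict Implicit.
Unset Printing Implicit Defensive.

Record sgraph := SGraph {
  vertex :> finType;
  adj : rel vertex;
  adj_sym : symmetric adj;
  adj_irrefl : irreflexive adj }.

Definition edges (H : sgraph) : {set {set H}} :=
  [set [set p.1; p.2] | p : H * H & adj p.1 p.2].

Definition incident (H : sgraph) (v : H) : {set {set H}} :=
  [set f in edges H | v \in f].

Definition degree (H : sgraph) (v : H) : nat := #|incident v|.

Definition adj_avoiding (H : sgraph) (X : {set H}) : rel H :=
  [rel x y | [&& x \notin X, y \notin X & adj x y]].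

Definition k_connected (k : nat) (H : sgraph) : Prop :=
  k < #|H| /\
  forall X : {set H}, #|X| < k ->
    forall x y : H, x \notin X -> y \notin X -> connect (adj_avoiding X) x y.

Section Planarity.
Local Open Scope ring_scope.

Definition plane_arc (R : realType) (p q : R * R) (A : set (R * R)) : Prop :=
  exists g : R -> R * R,
    [/\ {within `[0, 1], continuous g}%classic,
        {in `[0, 1] &, injective g},
        g 0 = p, g 1 = q & A = (g @` `[0, 1])%classic].

(* The third and fourth clauses say that the interior of an edge contains no
   vertex and no point of another edge. *)
Definition plane_drawing (R : realType) (H : sgraph)
    (pt : H -> R * R) (A : {set H} -> set (R * R)) : Prop :=
  [/\ injective pt,
      forall x y : H, adj x y -> plane_arc (pt x) (pt y) (A [set x; y]),
      forall (f : {set H}) (z : H), f \in edges H -> A f (pt z) -> z \in f &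
      forall (f g : {set H}) (p : R * R), f \in edges H -> g \in edges H ->
        f != g -> A f p -> A g p -> exists2 z : H, z \in f & p = pt z].

Definition planar (R : realType) (H : sgraph) : Prop :=
  exists (pt : H -> R * R) (A : {set H} -> set (R * R)), plane_drawing pt A.

End Planarity.

Variant label := lab0 | laba | labb.

Lemma label_eq_dec : comparable label.
Proof. by case; case; (by left) || (by right). Qed.

HB.instance Definition _ := hasDecEq.Build label (compareP label_eq_dec).

(* A labeling is a function on all sets of vertices, of which only the values
   on the edges matter. *)
Definition label_degree (H : sgraph) (c : {set H} -> label) (x : label)
    (v : H) : nat :=
  #|[set f in incident v | c f == x]|.

(* N is the set of negative vertices. *)
Definition weak_labeling (H : sgraph) (N : {set H}) (c : {set H} -> label)
    : Prop :=
  forall v : H,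
    [/\ label_degree c lab0 v = degree v %[mod 2],
        v \notin N -> label_degree c laba v = label_degree c labb v %[mod 2] /\
                      label_degree c labb v = degree v %[mod 2] &
        v \in N -> label_degree c laba v = label_degree c labb v %[mod 2] /\
                   label_degree c labb v = degree v + 1 %[mod 2]].

Definition strong_labeling (H : sgraph) (N : {set H}) (c : {set H} -> label)
    : Prop :=
  weak_labeling N c /\
  forall v : H, odd (degree v) -> label_degree c lab0 v < degree v.

(* Main.v *)
(* A weak labeling can only fail to be strong at a negative vertex v of odd
   degree all of whose edges are labeled 0.  Replace such a v, inside a small
   disc, by a cube minus a vertex: v, T1, T2 are the corners carrying the edges
   of v (one edge each moves to T1 and T2), the hexagon is v S3 T1 S1 T2 S2, and
   Hub is adjacent to S1, S2, S3; exactly S1, S2, S3 are negative.  Contracting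
   the gadget turns a weak labeling of the new graph into a weak labeling of the
   old one.  If all the edges of v were then labeled 0, the positive vertices
   v, T1, T2 would force nonzero labels on the whole hexagon, so that the negative
   cubic vertices S1, S2, S3 would send label 0 to Hub, which is impossible for a
   positive cubic vertex.  Hence the new labeling is strong at v, and one repeats
   this at the other odd negative vertices.

   The new graph is 3-connected because three disjoint paths lead from each
   gadget vertex to three distinct neighbours of v.  For planarity, cut each edge
   at v where it last leaves a disc that meets nothing but v and its edges.  The
   cone spanned by the two exit points with the largest inner product contains no
   other exit point: the gadget is drawn in the triangle they form with v, and
   the other edges of v are completed by radii. *)

Require Import Defs.
From HB Require Import structures.
From mathcomp Require Import all_boot all_order all_algebra.
From mathcomp Require Import all_classical all_reals all_analysis.
From mathcomp Require Import zify ring lra.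
Import Order.TTheory GRing.Theory Num.Theory.
Import numFieldNormedType.Exports.
Set Implicit Arguments.
Unset Strict Implicit.
Unset Printing Implicit Defensive.

(** * Arcs in the plane *)

Section Arcs.
Variable R : realType.
Local Open Scope classical_set_scope.
Local Open Scope ring_scope.
Implicit Types (p q m : R * R) (A B : set (R * R)).

Lemma continuous_pair (T : topologicalType) (f g : T -> R) :
  continuous f -> continuous g -> continuous (fun t => (f t, g t)).
Proof. by move=> cf cg t; exact: (cvg_pair (cf t) (cg t)). Qed.

Lemma continuous_fst2 (T : topologicalType) (f : T -> R * R) :
  continuous f -> continuous (fun t => (f t).1).
Proof. by move=> cf t; apply: continuous_comp; [exact: cf|exact: cvg_fst]. Qed.

Lemma continuous_snd2 (T : topologicalType) (f : T -> R * R) :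
  continuous f -> continuous (fun t => (f t).2).
Proof. by move=> cf t; apply: continuous_comp; [exact: cf|exact: cvg_snd]. Qed.

Lemma continuous_affine (a b : R) : continuous (fun t : R => a * t + b).
Proof.
by move=> t; apply: cvgD; [apply: cvgM; [exact: cvg_cst|exact: cvg_id]|exact: cvg_cst].
Qed.

(* Precomposing with the clamp [t |-> max 0 (min 1 t)] turns a parametrization
   on [0, 1] into one that is continuous on the whole line. *)
Lemma plane_arc_extend p q A : plane_arc p q A ->
  exists g : R -> R * R,
    [/\ continuous g, {in `[0, 1] &, injective g},
        forall t, t <= 0 -> g t = p, forall t, 1 <= t -> g t = q &
        A = g @` `[0, 1]].
Proof.
case=> g [cg ig g0 g1 ->].
pose cl (t : R) : R := Num.max 0 (Num.min 1 t).
have cl01 t : `[0, 1]%classic (cl t).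
  by rewrite /= in_itv /= /cl le_max lexx ge_max ler01 ge_min lexx.
have clK t : t \in `[0, 1] -> cl t = t.
  by rewrite in_itv /= /cl => /andP[t0 t1]; rewrite min_r // max_r.
exists (g \o cl); split.
- have /subspace_continuousP cg' := cg.
  move=> t; apply: (@cvg_comp _ _ _ cl g _ (within `[0, 1] (nbhs (cl t)))).
    move=> P; rewrite /within /= nbhs_simpl => HP.
    have ccl : {for t, continuous cl}.
      apply: (@continuous_max R R (fun=> 0) (fun t => Num.min 1 t)).
        exact: cvg_cst.
      apply: (@continuous_min R R (fun=> 1) id); first exact: cvg_cst.
      exact: cvg_id.
    have := ccl _ HP; rewrite /= nbhs_simpl /=.
    by apply: filterS => s /=; apply; exact: cl01.
  exact: cg'.
- by move=> s t s01 t01; rewrite /= !clK //; exact: ig.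
- by move=> t t0; rewrite /= /cl [Num.min _ _]min_r ?(le_trans t0) // max_l.
- by move=> t t1; rewrite /= /cl min_l // max_r.
- apply/seteqP; split=> z [t t01 <-]; exists t => //=; rewrite clK //.
Qed.

Lemma plane_arc_sym p q A : plane_arc p q A -> plane_arc q p A.
Proof.
move=> /plane_arc_extend[g [cg ig g0 g1 ->]].
have itvB (t : R) : t \in `[0, 1] -> 1 - t \in `[0, 1].
  by rewrite !in_itv /= => /andP[t0 t1]; apply/andP; split; lra.
exists (fun t => g (1 - t)); split.
- apply: continuous_subspaceT => t; apply: continuous_comp; last exact: cg.
  by apply: cvgB; [exact: cvg_cst|exact: cvg_id].
- by move=> s t /itvB s01 /itvB t01 /(ig _ _ s01 t01); lra.
- by rewrite subr0 g1.
- by rewrite subrr g0.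
- apply/seteqP; split=> z [t t01 <-]; exists (1 - t); rewrite ?subKr //;
    exact: itvB.
Qed.

Lemma plane_arc_segment p q : p != q ->
  plane_arc p q [set z | exists2 t : R, 0 <= t <= 1 &
    z = (p.1 + t * (q.1 - p.1), p.2 + t * (q.2 - p.2))].
Proof.
move=> pq; exists (fun t => (p.1 + t * (q.1 - p.1), p.2 + t * (q.2 - p.2))).
split.
- apply: continuous_subspaceT; apply: continuous_pair => t;
    (apply: cvgD; [exact: cvg_cst|apply: cvgM; [exact: cvg_id|exact: cvg_cst]]).
- move=> s t _ _ [] /addrI e1 /addrI e2.
  apply/eqP; apply: contraNT pq => st.
  have d1 : q.1 - p.1 = 0.
    by apply: (mulfI (x := s - t)); rewrite ?subr_eq0 // mulrBl e1 subrr mulr0.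
  have d2 : q.2 - p.2 = 0.
    by apply: (mulfI (x := s - t)); rewrite ?subr_eq0 // mulrBl e2 subrr mulr0.
  move: d1 d2 => /eqP; rewrite subr_eq0 => /eqP d1 /eqP.
  rewrite subr_eq0 => /eqP d2.
  by rewrite [p]surjective_pairing [q]surjective_pairing d1 d2.
- by rewrite !mul0r !addr0 -surjective_pairing.
- by rewrite !mul1r !subrKC -surjective_pairing.
- apply/seteqP; split=> z /= [t t01]; first by move=> ->; exists t; rewrite //= in_itv.
  by move=> <-; exists t; move: t01; rewrite in_itv.
Qed.

Lemma plane_arc_concat p m q A B : plane_arc p m A -> plane_arc m q B ->
  (forall z, A z -> B z -> z = m) -> plane_arc p q (A `|` B).
Proof.
move=> /plane_arc_extend[g [cg ig g0 g1 ->]].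
move=> /plane_arc_extend[k [ck ik k0 k1 ->]] gk.
(* The extended [g] stays at [m] after time 1 and the extended [k] stays at [m] before time 0. This
   single formula is therefore continuous and agrees with each arc on its half. *)
pose h t := ((g (2 * t)).1 + (k (2 * t - 1)).1 - m.1,
             (g (2 * t)).2 + (k (2 * t - 1)).2 - m.2).
have h1 t : t <= 1/2 -> h t = g (2 * t).
  move=> t2; rewrite /h k0; last by lra.
  by rewrite !addrK -surjective_pairing.
have h2 t : 1/2 <= t -> h t = k (2 * t - 1).
  move=> t2; rewrite /h g1; last by lra.
  by rewrite [_ + (k _).1]addrC [_ + (k _).2]addrC !addrK -surjective_pairing.
have G1 (t : R) : 0 <= t -> t <= 1 / 2 -> 2 * t \in `[0, 1].
  by move=> a b; rewrite in_itv /=; apply/andP; split; lra.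
have K1 (t : R) : 1 / 2 <= t -> t <= 1 -> 2 * t - 1 \in `[0, 1].
  by move=> a b; rewrite in_itv /=; apply/andP; split; lra.
have I0 : (0 : R) \in `[0, 1] by rewrite in_itv /= lexx ler01.
(* A point common to both halves is [m], which each injective arc reaches only at the middle
   time. *)
have mix s t : 0 <= s -> s <= 1 / 2 -> 1 / 2 <= t -> t <= 1 ->
    g (2 * s) = k (2 * t - 1) -> s = t.
  move=> s0 s2 t2 t1 e.
  have gm : g (2 * s) = m.
    apply: gk; first by exists (2 * s) => //; exact: G1.
    by exists (2 * t - 1) => //; exact: K1.
  have : 2 * t - 1 = 0.
    apply: ik => //; first exact: K1.
    by rewrite -e gm k0.
  have : 2 * s = 1.
    apply: ig; first exact: G1.
      by rewrite in_itv /= lexx ler01.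
    by rewrite gm g1.
  lra.
exists h; split.
- apply: continuous_subspaceT.
  have cg2 : continuous (fun t : R => g (2 * t)).
    move=> t; apply: continuous_comp; last exact: cg.
    by apply: cvgM; [exact: cvg_cst|exact: cvg_id].
  have ck2 : continuous (fun t : R => k (2 * t - 1)).
    move=> t; apply: continuous_comp; last exact: ck.
    by apply: cvgD; [apply: cvgM; [exact: cvg_cst|exact: cvg_id]|exact: cvg_cst].
  apply: continuous_pair => t; (apply: cvgB; [apply: cvgD|exact: cvg_cst]).
  + exact: (continuous_fst2 cg2).
  + exact: (continuous_fst2 ck2).
  + exact: (continuous_snd2 cg2).
  + exact: (continuous_snd2 ck2).
- move=> s t; rewrite !in_itv /= => /andP[s0 s1] /andP[t0 t1].
  have [s2|/ltW s2] := leP s (1/2); have [t2|/ltW t2] := leP t (1/2).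
  + rewrite !h1 // => /ig; rewrite !G1 // => /(_ isT isT); lra.
  + by rewrite h1 // h2 //; apply: mix.
  + by rewrite h2 // h1 // => e; apply/esym/mix.
  + rewrite !h2 // => /ik; rewrite !K1 // => /(_ isT isT); lra.
- by rewrite h1; [rewrite g0 //; lra|lra].
- by rewrite h2; [rewrite k1 //; lra|lra].
- apply/seteqP; split=> z.
  + case=> -[t /= t01 <-]; move: t01; rewrite in_itv /= => /andP[t0 t1].
      exists (t / 2); first by rewrite /= in_itv /=; apply/andP; split; lra.
      rewrite h1; last by lra.
      by congr g; field.
    exists ((t + 1) / 2); first by rewrite /= in_itv /=; apply/andP; split; lra.
    rewrite h2; last by lra.
    by congr k; field.
  + case=> t /= t01 <-; move: t01; rewrite in_itv /= => /andP[t0 t1].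
    have [t2|/ltW t2] := leP t (1/2).
      by left; exists (2 * t); rewrite ?h1 //; exact: G1.
    by right; exists (2 * t - 1); rewrite ?h2 //; exact: K1.
Qed.

Lemma plane_arc_compact p q A : plane_arc p q A -> compact A.
Proof.
case=> g [cg _ _ _ ->]; apply: continuous_compact => //.
exact: segment_compact.
Qed.

(* The tail starts at the last time the arc meets the level [r] of [rho]. *)
Lemma plane_arc_tail p q A (rho : R * R -> R) (r : R) :
  continuous rho -> plane_arc p q A -> rho p < r -> r < rho q ->
  exists m B, [/\ plane_arc m q B, B `<=` A, B m, rho m = r &
    forall z, B z -> z = m \/ r < rho z].
Proof.
move=> crho /plane_arc_extend[g [cg ig g0 g1 ->]] rp rq.
have crg : continuous (rho \o g).
  by move=> t; apply: continuous_comp; [exact: cg|exact: crho].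
pose K := `[0, 1] `&` ((rho \o g) @^-1` [set x | x <= r]).
have K0 : K 0 by split; rewrite /= ?in_itv /= ?lexx ?ler01 // g0 // ltW.
have cK : compact K.
  apply: compact_closedI; first exact: segment_compact.
  by apply: preimage_closed (@closed_le _ r) => t _; exact: crg.
(* Maximizing the identity on the compact set [K] yields the last time [tau] at which [rho] is at
   most [r]. *)
have [||tau /set_mem Ktau tauP] := @compact_EVT_max _ R id K _ cK.
- by exists 0.
- by apply: continuous_subspaceT => t; exact: cvg_id.
have [] := Ktau; rewrite /= in_itv /= => /andP[tau0 tau1] rtau.
have after t : tau < t -> t <= 1 -> r < rho (g t).
  move=> taut t1; rewrite ltNge; apply/negP => rt.
  have /tauP : t \in K.
    by apply/mem_set; split=> //=; rewrite in_itv /= t1 andbT; lra.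
  by rewrite leNgt taut.
have taul : tau < 1.
  rewrite lt_neqAle tau1 andbT; apply/eqP => e.
  by move: rtau; rewrite e g1 // leNgt rq.
(* The intermediate value theorem gives a time in [[tau], 1] at level [r]; a time later than [tau]
   is excluded by [after]. *)
have rhoT : rho (g tau) = r.
  have [||t] := @IVT _ (rho \o g) tau 1 r tau1.
  - exact: continuous_subspaceT.
  - rewrite /= (g1 1) //; apply/andP; split.
      by rewrite ge_min rtau.
    by rewrite le_max (ltW rq) orbT.
  rewrite in_itv /= => /andP[]; rewrite le_eqVlt => /predU1P[<- //|tt t1] e.
  by have := after _ tt t1; rewrite e ltxx.
exists (g tau), (g @` `[tau, 1]); split.
- exists (fun t => g ((1 - tau) * t + tau)).
  have im (t : R) : t \in `[0, 1] -> (1 - tau) * t + tau \in `[0, 1].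
    rewrite !in_itv /= => /andP[t0 t1]; apply/andP; split; nra.
  split.
  + apply: continuous_subspaceT => t; apply: continuous_comp; last exact: cg.
    exact: continuous_affine.
  + move=> s t /im s1 /im t1 /(ig _ _ s1 t1) /addIr.
    by apply: mulfI; rewrite subr_eq0 gt_eqF.
  + by rewrite mulr0 add0r.
  + by rewrite mulr1 subrK g1.
  + apply/seteqP; split=> z [t /= t01 <-]; move: t01; rewrite in_itv /= => /andP[t0 t1].
      exists ((t - tau) / (1 - tau)).
        rewrite /= in_itv /= divr_ge0 ?subr_ge0 //= ler_pdivrMr ?subr_gt0 //.
        by rewrite mul1r lerD2r.
      by rewrite mulrC divfK ?subr_eq0 ?gt_eqF // subrK.
    exists ((1 - tau) * t + tau) => //.
    by rewrite /= in_itv /=; apply/andP; split; nra.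
- move=> z [t /= t01 <-]; exists t => //; move: t01; rewrite /= !in_itv /=.
  by move=> /andP[t0 ->]; rewrite (le_trans tau0).
- by exists tau => //; rewrite /= in_itv /= lexx.
- exact: rhoT.
- move=> z [t /= t01 <-]; move: t01; rewrite in_itv /= => /andP[].
  rewrite le_eqVlt => /predU1P[<- _|tt t1]; first by left.
  by right; exact: after.
Qed.

End Arcs.

(** * Degrees and connectivity *)

Section Graphs.
Implicit Types (H : sgraph).

Definition neighbours H (v : H) : {set H} := [set w | adj v w].

Lemma edgesP H (f : {set H}) :
  reflect (exists x y, adj x y /\ f = [set x; y]) (f \in edges H).
Proof.
apply: (iffP imsetP) => [[[x y] xy ->]|[x [y [xy ->]]]].
  by exists x, y; rewrite inE in xy.
by exists (x, y); rewrite ?inE.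
Qed.

Lemma mem_edges H (x y : H) : adj x y -> [set x; y] \in edges H.
Proof. by move=> xy; apply/edgesP; exists x, y. Qed.

Lemma set2_injr (T : finType) (v : T) : injective (fun w => [set v; w]).
Proof.
move=> w w' e; have : w \in [set v; w'] by rewrite -e set22.
have : w' \in [set v; w] by rewrite e set22.
by rewrite !inE => /orP[/eqP->|/eqP//] /orP[] /eqP.
Qed.

(** An edge at [v] is determined by its other end, so counts of incident edges become sums over
    vertices, which split well over the gadget graph. *)
Lemma incident_sub H (v : H) (P : pred {set H}) :
  #|[set f in incident v | P f]| = \sum_(w : H) (adj v w && P [set v; w]).
Proof.
rewrite -big_mkcond /= sum1_card -(card_imset _ (@set2_injr H v)).
apply: eq_card => f; rewrite !inE; apply/idP/imsetP.
  case/andP=> /andP[/edgesP[x [y [xy ->]]]]; rewrite !inE => /orP[] /eqP-> Pf.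
    by exists y; rewrite // unfold_in xy.
  by rewrite finset.setUC; exists x; rewrite // unfold_in adj_sym xy finset.setUC.
case=> w; rewrite unfold_in => /andP[vw Pw] ->.
by rewrite mem_edges // set21 Pw.
Qed.

Lemma label_degreeE H (c : {set H} -> label) x (v : H) :
  label_degree c x v = \sum_(w : H) (adj v w && (c [set v; w] == x)).
Proof. exact: incident_sub. Qed.

Lemma degreeE H (v : H) : degree v = \sum_(w : H) adj v w.
Proof.
rewrite -[RHS](eq_bigr _ (fun w _ => congr1 nat_of_bool (andbT (adj v w)))).
rewrite -(incident_sub v predT); apply: eq_card => f.
by rewrite !inE andbT.
Qed.

Lemma degree_neighbours H (v : H) : degree v = #|neighbours v|.
Proof.
rewrite degreeE -big_mkcond /= sum1_card; apply: eq_card => w.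
by rewrite !inE.
Qed.

Lemma label_eqE : ((lab0 == laba) = false) * ((lab0 == labb) = false) *
  ((laba == lab0) = false) * ((laba == labb) = false) *
  ((labb == lab0) = false) * ((labb == laba) = false).
Proof. by do ![split]; apply/eqP. Qed.

Lemma degree_labels H (c : {set H} -> label) (v : H) :
  degree v = label_degree c lab0 v + label_degree c laba v
             + label_degree c labb v.
Proof.
rewrite degreeE !label_degreeE -!big_split /=; apply: eq_bigr => w _.
by case: (adj v w) => //=; case: (c _); rewrite ?eqxx ?label_eqE.
Qed.

(** In boolean form a negative sign is an exclusive or with [v \in N], and both signs are handled at
    once. *)
Lemma weak_labelingP H (N : {set H}) c :
  weak_labeling N c <-> forall v : H,
    [/\ odd (label_degree c lab0 v) = odd (degree v),
        odd (label_degree c laba v) = odd (degree v) (+) (v \in N) &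
        odd (label_degree c labb v) = odd (degree v) (+) (v \in N)].
Proof.
have modE m n : (m = n %[mod 2]) <-> odd m = odd n.
  rewrite !modn2; split=> [/eqP|->//].
  by case: (odd m); case: (odd n).
split=> wc v; have := wc v.
  case=> /modE-> pos neg; split=> //.
    case vN: (v \in N).
      by have [/modE-> /modE->] := neg vN; rewrite oddD addbT.
    by have [/modE-> /modE->] := pos (negbT vN); rewrite addbF.
  case vN: (v \in N).
    by have [_ /modE->] := neg vN; rewrite oddD addbT.
  by have [_ /modE->] := pos (negbT vN); rewrite addbF.
case=> d0 da db; split; first exact/modE.
  by move=> /negbTE vN; split; apply/modE; rewrite ?da ?db vN ?addbF.
by move=> vN; split; apply/modE; rewrite ?da ?db vN ?oddD // addbT.
Qed.

Lemma adj_avoiding_sym H (X : {set H}) : symmetric (adj_avoiding X).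
Proof. by move=> x y; rewrite /adj_avoiding /= andbCA adj_sym. Qed.

Lemma connect_avoiding_sym H (X : {set H}) :
  connect_sym (adj_avoiding X).
Proof. exact/sym_connect_sym/adj_avoiding_sym. Qed.

Lemma avoiding_path H (X : {set H}) x p :
  path.path (@adj H) x p -> x \notin X -> all [predC X] p ->
  connect (adj_avoiding X) x (last x p).
Proof.
elim: p x => [|y p IHp] x /=; first by rewrite connect0.
case/andP=> xy yp xX /andP[yX pX].
by apply: connect_trans (IHp y yp yX pX); apply: connect1; rewrite /adj_avoiding /= xX yX.
Qed.

(** If [X] met all three disjoint sequences, it would contain three distinct elements. *)
Lemma fan_avoids (T : finType) (X : {set T}) (p q s : seq T) :
  #|X| < 3 -> uniq (p ++ q ++ s) ->
  [|| all [predC X] p, all [predC X] q | all [predC X] s].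
Proof.
move=> X3; apply: contraLR; rewrite !negb_or -!has_predC.
case/and3P=> /hasP[x xp /negPn/= xX] /hasP[y yq /negPn/= yX] /hasP[z zs /negPn/= zX].
apply: contraTN X3 => u; rewrite -leqNgt.
apply: leq_trans (subset_leq_card (_ : [set x; y; z] \subset X)); last first.
  by apply/fintype.subsetP => t; rewrite !inE -orbA => /or3P[]/eqP->.
move: u; rewrite !cat_uniq => /and3P[_ /hasPn pqs /and3P[_ /hasPn qs _]].
have yp : y \notin p by apply: pqs; rewrite mem_cat yq.
have zp : z \notin p by apply: pqs; rewrite mem_cat zs orbT.
have zq : z \notin q by apply: qs.
have xy : x != y by apply: contraNneq yp => <-.
have xz : x != z by apply: contraNneq zp => <-.
have yz : y != z by apply: contraNneq zq => <-.
by rewrite -finset.setUA cardsU1 cards2 !inE negb_or xy xz yz.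
Qed.

(** With fewer than [k] neighbours, deleting them would isolate [v] from some remaining vertex,
    which exists because [H] has more than [k] vertices. *)
Lemma k_connected_degree k H (v : H) : k_connected k H -> k <= degree v.
Proof.
case=> kH conn; rewrite degree_neighbours leqNgt; apply/negP => small.
have vN : v \notin neighbours v by rewrite inE adj_irrefl.
have [y yN] : exists y, y \notin v |: neighbours v.
  apply/existsP; rewrite -negb_forall; apply/negP => /forallP all_in.
  have : #|H| <= #|v |: neighbours v|.
    by rewrite -cardsT subset_leq_card //; apply/fintype.subsetP => z _; apply: all_in.
  by rewrite cardsU1 vN leqNgt (leq_ltn_trans _ kH).
move: yN; rewrite in_setU1 negb_or => /andP[yv yN].
have /connectP[[|z p] /= vp ey] := conn _ small v y vN yN.
  by rewrite ey eqxx in yv.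
by move: vp => /andP[/and3P[_ + vz]]; rewrite inE vz.
Qed.

End Graphs.

(** * The gadget *)

Variant gadget := T1 | T2 | S1 | S2 | S3 | Hub.

Definition gadget_code (g : gadget) : 'I_6 :=
  match g with
  | T1 => @Ordinal 6 0 isT | T2 => @Ordinal 6 1 isT | S1 => @Ordinal 6 2 isT
  | S2 => @Ordinal 6 3 isT | S3 => @Ordinal 6 4 isT | Hub => @Ordinal 6 5 isT
  end.

Definition gadget_decode (i : 'I_6) : gadget :=
  nth T1 [:: T1; T2; S1; S2; S3; Hub] i.

Lemma gadget_codeK : cancel gadget_code gadget_decode.
Proof. by case. Qed.

HB.instance Definition _ := Finite.copy gadget (can_type gadget_codeK).

Lemma big_gadget (F : gadget -> nat) :
  \sum_(g : gadget) F g = F T1 + F T2 + F S1 + F S2 + F S3 + F Hub.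
Proof.
rewrite (perm_big [:: T1; T2; S1; S2; S3; Hub]) /=.
  by rewrite !big_cons big_nil addn0 !addnA.
apply: uniq_perm; [exact: index_enum_uniq|by []|].
by case; rewrite mem_index_enum !inE.
Qed.

(** These are the gadget edges away from [v]. The deleted corner of the cube is the one opposite to
    [Hub]; its three neighbours would be [v], [T1] and [T2]. *)
Definition gadget_adj (g h : gadget) : bool :=
  match g, h with
  | T1, S1 | S1, T1 | T1, S3 | S3, T1 | T2, S1 | S1, T2 | T2, S2 | S2, T2
  | Hub, S1 | S1, Hub | Hub, S2 | S2, Hub | Hub, S3 | S3, Hub => true
  | _, _ => false
  end.

Section GadgetGraph.
Variables (H : sgraph) (v w1 w2 : H).

Definition moved (x y : H) : bool :=
  ((x == v) && ((y == w1) || (y == w2))) || ((y == v) && ((x == w1) || (x == w2))).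

Definition kept (x y : H) : bool := adj x y && ~~ moved x y.

Definition attached (x : H) (g : gadget) : bool :=
  match g with
  | T1 => x == w1 | T2 => x == w2 | S2 | S3 => x == v | _ => false
  end.

Definition gg_adj (x y : H + gadget) : bool :=
  match x, y with
  | inl x, inl y => kept x y
  | inl x, inr g => attached x g
  | inr g, inl x => attached x g
  | inr g, inr h => gadget_adj g h
  end.

Lemma kept_sym : symmetric kept.
Proof. by move=> x y; rewrite /kept /moved adj_sym orbC. Qed.

Lemma gg_adj_sym : symmetric gg_adj.
Proof.
move=> [x|g] [y|h] //=; first exact: kept_sym.
by case: g; case: h.
Qed.

Lemma gg_adj_irrefl : irreflexive gg_adj.
Proof. by case=> [x|[]] //=; rewrite /kept adj_irrefl. Qed.

Definition gadget_graph : sgraph := SGraph gg_adj_sym gg_adj_irrefl.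

Definition gadget_negative (N : {set H}) : {set gadget_graph} :=
  [set z : H + gadget | match z with
   | inl x => (x \in N) && (x != v)
   | inr (S1 | S2 | S3) => true
   | inr _ => false
   end].

Lemma big_gadget_graph (F : gadget_graph -> nat) :
  \sum_z F z = \sum_(x : H) F (inl x) + \sum_(g : gadget) F (inr g).
Proof. exact: big_sumType. Qed.

Lemma card_gadget_graph : #|gadget_graph| = #|H| + 6.
Proof. by rewrite -sum1_card big_gadget_graph big_gadget sum1_card. Qed.

(** One negative vertex, [v], becomes positive and three are created, so the number changes by
    two. *)
Lemma odd_gadget_negative (N : {set H}) :
  v \in N -> odd #|gadget_negative N| = odd #|N|.
Proof.
move=> vN; rewrite (cardsD1 v N) vN -sum1_card big_mkcond big_gadget_graph.
rewrite big_gadget !inE /= !addn0 !addn1 -big_mkcond /= sum1_card !oddD /=.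
rewrite addbC /=; congr (~~ odd _); apply: eq_card => x.
rewrite [LHS](_ : _ = (inl x \in gadget_negative N)) //.
by rewrite !inE andbC.
Qed.

Hypotheses (w12 : w1 != w2) (vw1 : adj v w1) (vw2 : adj v w2).

Let w1v : w1 != v. Proof. by apply: contraTneq vw1 => ->; rewrite adj_irrefl. Qed.
Let w2v : w2 != v. Proof. by apply: contraTneq vw2 => ->; rewrite adj_irrefl. Qed.

(** * 3-connectivity of the gadget graph *)

Section Connectivity.
Variable w3 : H.
Hypotheses (vw3 : adj v w3) (w31 : w3 != w1) (w32 : w3 != w2).

Let w3v : w3 != v. Proof. by apply: contraTneq vw3 => ->; rewrite adj_irrefl. Qed.

(** From each gadget vertex, [v] included, explicit paths to [w1], [w2] and [w3] share only their
    start; fewer than three deleted vertices leave one of them intact. *)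
Lemma gadget_fan (X : {set gadget_graph}) (z : gadget_graph) :
  #|X| < 3 -> (if z is inl x then x == v else true) -> z \notin X ->
  exists2 w : H, w != v /\ inl w \notin X & connect (adj_avoiding X) z (inl w).
Proof.
move=> X3 zG zX.
have vkw3 : kept v w3.
  by rewrite /kept vw3 /moved eqxx (negbTE w31) (negbTE w32) (negbTE w3v).
have fan (p q s : seq gadget_graph) :
    uniq ((rcons p (inl w1)) ++ (rcons q (inl w2)) ++ (rcons s (inl w3))) ->
    path.path (@adj gadget_graph) z (rcons p (inl w1)) ->
    path.path (@adj gadget_graph) z (rcons q (inl w2)) ->
    path.path (@adj gadget_graph) z (rcons s (inl w3)) ->
    exists2 w : H, w != v /\ inl w \notin X & connect (adj_avoiding X) z (inl w).
  have conc (w : H) (t : seq gadget_graph) : w != v ->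
      path.path (@adj gadget_graph) z (rcons t (inl w)) ->
      all [predC X] (rcons t (inl w)) ->
      exists2 w : H, w != v /\ inl w \notin X & connect (adj_avoiding X) z (inl w).
    move=> wv pt Xt; exists w; last first.
      by rewrite -[inl w](last_rcons z t); apply: avoiding_path.
    by split=> //; move: Xt; rewrite all_rcons => /andP[].
  move=> u pp pq ps; case/or3P: (fan_avoids X3 u).
  - exact: conc pp.
  - exact: conc pq.
  - exact: conc ps.
have inlE (x y : H) : (inl x == inl y :> gadget_graph) = (x == y) by [].
have inlrE (x : H) g : (inl x == inr g :> gadget_graph) = false by [].
have inrlE (x : H) g : (inr g == inl x :> gadget_graph) = false by [].
have inrE g h : (inr g == inr h :> gadget_graph) = (g == h) by [].
have e := (in_cons, in_nil, inlE, inlrE, inrlE, inrE, eqxx,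
  negbTE w12, negbTE w31, negbTE w32, negbTE w1v,
  negbTE w2v, negbTE w3v, eq_sym v w1, eq_sym v w2, eq_sym v w3, eq_sym w1 w3,
  eq_sym w2 w3, vkw3).
case: z zG zX fan => [x /eqP-> _|[] _ _] fan.
- by apply: (fan [:: inr S3; inr T1] [:: inr S2; inr T2] [::]); rewrite /= ?e.
- by apply: (fan [::] [:: inr S1; inr T2] [:: inr S3; inl v]); rewrite /= ?e.
- by apply: (fan [:: inr S1; inr T1] [::] [:: inr S2; inl v]); rewrite /= ?e.
- by apply: (fan [:: inr T1] [:: inr T2] [:: inr Hub; inr S3; inl v]); rewrite /= ?e.
- by apply: (fan [:: inr Hub; inr S1; inr T1] [:: inr T2] [:: inl v]); rewrite /= ?e.
- by apply: (fan [:: inr T1] [:: inr Hub; inr S1; inr T2] [:: inl v]); rewrite /= ?e.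
- by apply: (fan [:: inr S1; inr T1] [:: inr S2; inr T2] [:: inr S3; inl v]); rewrite /= ?e.
Qed.

End Connectivity.

(** A path of [H] avoiding a suitable small set [Y] is lifted, edge by edge, to a connection of the
    gadget graph avoiding [X]. *)
Lemma gadget_graph_connected : k_connected 3 H -> k_connected 3 gadget_graph.
Proof.
move=> H3; have [H4 conn] := H3; split; first by rewrite card_gadget_graph ltn_addr.
have [w3 vw3 /andP[w31 w32]] : exists2 w3, adj v w3 & (w3 != w1) && (w3 != w2).
  have : 0 < #|neighbours v :\ w1 :\ w2|.
    have := k_connected_degree v H3; rewrite degree_neighbours.
    by rewrite (cardsD1 w1) (cardsD1 w2 (_ :\ _)) !inE vw1 vw2 eq_sym w12.
  by case/card_gt0P=> w3; rewrite !inE => /and3P[? ? ?]; exists w3 => //; apply/andP.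
move=> X X3 x y xX yX.
pose inG (z : gadget_graph) : bool := if z is inl u then u == v else true.
have lift (Y : {set H}) : #|Y| < 3 ->
    (forall u u', adj u u' -> u \notin Y -> u' \notin Y ->
       connect (adj_avoiding X) (inl u) (inl u' : gadget_graph)) ->
    forall u u', u \notin Y -> u' \notin Y ->
       connect (adj_avoiding X) (inl u) (inl u' : gadget_graph).
  move=> Y3 step u u' uY u'Y; have /connectP[p] := conn Y Y3 u u' uY u'Y.
  elim: p u {uY} => [|t p IHp] u /=; first by move=> _ ->; rewrite connect0.
  case/andP=> /and3P[uY tY ut] tp lp.
  by apply: connect_trans (step _ _ ut uY tY) (IHp _ tp lp).
(* It suffices that each edge of [H] outside [Y] can be simulated outside [X], and that each vertex
   outside [X] reaches an old vertex outside [Y]. *)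
suff [a [Y [Y3 step toY]]] : exists (a : H) (Y : {set H}), [/\ #|Y| < 3,
    forall u u', adj u u' -> u \notin Y -> u' \notin Y ->
       connect (adj_avoiding X) (inl u) (inl u' : gadget_graph) &
    forall z, z \notin X -> exists2 u, u \notin Y &
       connect (adj_avoiding X) z (inl u)].
  have [u uY xu] := toY x xX; have [u' u'Y yu'] := toY y yX.
  apply: connect_trans xu _; rewrite connect_avoiding_sym.
  apply: connect_trans yu' _; exact: (lift Y).
(* If [X] hits the gadget at [z0], take for [Y] the vertex [v] and the old vertices of [X]: [z0]
   pays for [v], so [Y] is still small. Edges outside [Y] miss [v] and hence are not moved, while
   gadget vertices escape along the fan. *)
have [/existsP[z0 /andP[z0X z0G]]|noG] := boolP [exists z, (z \in X) && inG z].
  pose Xo := [set u : H | (inl u \in X) && (u != v)].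
  exists v, (v |: Xo); split.
  - rewrite cardsU1 !inE eqxx andbF /= -[3]/(1 + 2) ltn_add2l.
    have inl_inj : injective (inl : H -> gadget_graph) by move=> ? ? [].
    rewrite -(card_imset _ inl_inj) -ltnS (leq_trans _ X3) // ltnS.
    rewrite [in leqRHS](cardsD1 z0) z0X ltnS subset_leq_card //.
    apply/fintype.subsetP => _ /imsetP[u + ->]; rewrite !inE => /andP[-> uv].
    by rewrite andbT; apply: contraNneq uv => e; move: z0G; rewrite -e.
  - move=> u u' uu'; rewrite !inE !negb_or !negb_and => /andP[uv].
    rewrite uv orbF => uX /andP[u'v]; rewrite u'v orbF => u'X.
    apply: connect1; rewrite /adj_avoiding /= uX u'X /= /kept uu' /moved.
    by rewrite (negbTE uv) (negbTE u'v).
  - move=> z zX; have [zG|zG] := boolP (inG z).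
      have [w [wv wX] zw] := gadget_fan vw3 w31 w32 X3 zG zX.
      by exists w; rewrite // !inE negb_or wv negb_and wX.
    case: z zX zG => [u|//] uX uv; exists u; last exact: connect0.
    by rewrite !inE negb_or negb_and uX uv.
have GX z : inG z -> z \notin X.
  by move=> zG; apply: contra noG => zX; apply/existsP; exists z; rewrite zX.
pose Xo := [set u : H | inl u \in X].
have Gconn (p : seq gadget_graph) (z : gadget_graph) :
    z \notin X -> path.path (@adj gadget_graph) z p -> all [predC X] p ->
    connect (adj_avoiding X) z (last z p).
  by move=> *; apply: avoiding_path.
have vX : inl v \notin X by apply: GX; rewrite /= eqxx.
have gX g : inr g \notin X by apply: GX.
exists v, Xo; split.
- have inl_inj : injective (inl : H -> gadget_graph) by move=> ? ? [].
  rewrite -(card_imset _ inl_inj); apply: leq_ltn_trans X3.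
  rewrite subset_leq_card //.
  by apply/fintype.subsetP => _ /imsetP[u + ->]; rewrite inE.
(* If [X] misses the gadget, a moved edge is replaced by a detour through [S3], [T1] or through
   [S2], [T2]. *)
- have via w : w = w1 \/ w = w2 -> w \notin Xo ->
      connect (adj_avoiding X) (inl v) (inl w : gadget_graph).
    case=> ->; rewrite inE => wX.
      by apply: (Gconn [:: inr S3; inr T1; inl w1]); rewrite /= ?eqxx ?gX ?wX.
    by apply: (Gconn [:: inr S2; inr T2; inl w2]); rewrite /= ?eqxx ?gX ?wX.
  move=> u u' uu' uX u'X; have [uu'k|] := boolP (moved u u'); last first.
    move: uX u'X; rewrite !inE => uX u'X uu'k.
    by apply: connect1; rewrite /adj_avoiding /= uX u'X /kept uu'.
  case/orP: uu'k => /andP[/eqP eqv /orP ww]; rewrite {}eqv in uX u'X *.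
    by apply: via => //; case: ww => /eqP; [left|right].
  rewrite connect_avoiding_sym.
  by apply: via => //; case: ww => /eqP; [left|right].
- move=> [u|g] zX; first by exists u; [rewrite inE|exact: connect0].
  exists v; first by rewrite inE.
  case: g zX => zX.
  + by apply: (Gconn [:: inr S3; inl v]); rewrite /= ?eqxx ?gX ?vX.
  + by apply: (Gconn [:: inr S2; inl v]); rewrite /= ?eqxx ?gX ?vX.
  + by apply: (Gconn [:: inr Hub; inr S3; inl v]); rewrite /= ?eqxx ?gX ?vX.
  + by apply: (Gconn [:: inl v]); rewrite /= ?eqxx ?gX ?vX.
  + by apply: (Gconn [:: inl v]); rewrite /= ?eqxx ?gX ?vX.
  + by apply: (Gconn [:: inr S3; inl v]); rewrite /= ?eqxx ?gX ?vX.
Qed.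

End GadgetGraph.

(** * Contracting a labeling *)

(** The variables are the parities of one label on the gadget edges, and [k] that on the kept edges
    at [v]. In the sum of the seven vertex equations each inner edge cancels; the four ones cancel
    too, and the three [z] leave one. *)
Lemma gadget_parity (z k s2 s3 e1 e2 a1 a3 b1 b2 h1 h2 h3 : bool) :
  k (+) (s2 (+) s3) -> e1 (+) a1 (+) a3 = true -> e2 (+) b1 (+) b2 = true ->
  a1 (+) b1 (+) h1 = z -> s2 (+) b2 (+) h2 = z -> s3 (+) a3 (+) h3 = z ->
  h1 (+) h2 (+) h3 = true -> k (+) (e1 (+) e2) = z.
Proof.
move=> + + + <-.
by case: a1 a3 e1 => [] [] [] //; case: b1 b2 e2 => [] [] [] //;
   case: k s2 s3 => [] [] [] //; case: h1 h2 h3 => [] [] [].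
Qed.

(** Two edges that carry both [laba] and [labb] an odd number of times are labeled [laba] and
    [labb]. This is the situation at a positive vertex of odd degree whose other edges are labeled
    [lab0]. *)
Lemma two_nonzero (p q : label) :
  odd ((p == laba) + (q == laba)) -> odd ((p == labb) + (q == labb)) ->
  p != lab0 /\ q != lab0.
Proof. by case: p; case: q; rewrite ?eqxx ?label_eqE. Qed.

(** The right-hand sides are false, as at a negative cubic vertex: both nonzero labels occur evenly,
    so [p] and [q] agree and [r] is left with [lab0]. *)
Lemma third_zero (p q r : label) : p != lab0 -> q != lab0 ->
  odd ((p == laba) + (q == laba) + (r == laba)) = (laba == lab0) ->
  odd ((p == labb) + (q == labb) + (r == labb)) = (labb == lab0) ->
  r = lab0.
Proof. by case: p; case: q; case: r; rewrite ?eqxx ?label_eqE. Qed.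

Lemma sum_pred1_and (T : finType) (a : T) (f : T -> bool) :
  \sum_(u : T) ((u == a) && f u) = f a.
Proof. by rewrite (bigD1 a) //= eqxx big1 ?addn0 // => u /negbTE->. Qed.

Section Labelings.
Variables (H : sgraph) (v w1 w2 : H).
Hypotheses (w12 : w1 != w2) (vw1 : adj v w1) (vw2 : adj v w2).
Let w1v : w1 != v. Proof. by apply: contraTneq vw1 => ->; rewrite adj_irrefl. Qed.
Let w2v : w2 != v. Proof. by apply: contraTneq vw2 => ->; rewrite adj_irrefl. Qed.
Let G := gadget_graph v w1 w2.
Variables (N : {set H}) (c : {set G} -> label).

Definition contracted_labeling (f : {set H}) : label :=
  if f == [set v; w1] then c [set inr T1; inl w1]
  else if f == [set v; w2] then c [set inr T2; inl w2]
  else c (inl @: f).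

Let kept_degree (P : pred {set G}) (u : H) : nat :=
  \sum_(w : H) (kept v w1 w2 u w && P [set inl u; inl w]).

Let moved_degree (P : pred {set G}) (u : H) : nat :=
  if u == v then P [set inr T1; inl w1] + P [set inr T2; inl w2]
  else ((u == w1) && P [set inr T1; inl w1])
       + ((u == w2) && P [set inr T2; inl w2]).

Lemma contracted_degree x (u : H) :
  label_degree contracted_labeling x u =
  kept_degree [pred f | c f == x] u + moved_degree [pred f | c f == x] u.
Proof.
pose Q w := contracted_labeling [set u; w] == x.
have Q1 : contracted_labeling [set v; w1] = c [set inr T1; inl w1].
  by rewrite /contracted_labeling eqxx.
have Q2 : contracted_labeling [set v; w2] = c [set inr T2; inl w2].
  rewrite /contracted_labeling eqxx ifN //.
  by apply: contra w12 => /eqP/set2_injr->.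
have split_adj w : (adj u w && Q w)  =
    (kept v w1 w2 u w && (c [set inl u; inl w] == x))
    + (adj u w && (moved v w1 w2 u w && Q w)) :> nat.
  rewrite /kept; case uw: (adj u w) => //=.
  have [mv|nmv] := boolP (moved v w1 w2 u w); first by rewrite add0n.
  have nset a : (a == w1) || (a == w2) -> [set u; w] != [set v; a].
    move=> aw; apply: contra nmv => /eqP e; rewrite /moved.
    have : u \in [set v; a] by rewrite -e set21.
    have : w \in [set v; a] by rewrite -e set22.
    rewrite !in_set2 => /orP[] /eqP ew /orP[] /eqP eu; move: uw; rewrite ew eu.
    - by rewrite adj_irrefl.
    - by rewrite eqxx aw orbT.
    - by rewrite eqxx aw.
    - by rewrite adj_irrefl.
  rewrite addn0 /Q /contracted_labeling imsetU1 imset_set1.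
  by rewrite !ifN ?nset ?eqxx ?orbT.
rewrite label_degreeE (eq_bigr _ (fun w _ => split_adj w)) big_split /=.
congr (_ + _); rewrite /moved_degree /moved; case: eqVneq => [uv|uv].
  rewrite (bigD1 w1) // (bigD1 w2) /=; last by rewrite eq_sym.
  rewrite big1 => [|w /andP[/negbTE-> /negbTE->]]; last first.
    by rewrite uv (eq_sym v) (negbTE w1v) (eq_sym v) (negbTE w2v) /= !andbF.
  by rewrite /Q uv vw1 vw2 !eqxx !orbT /= Q1 Q2 addn0.
rewrite (bigD1 v) //= big1 => [|w /negbTE->]; last by rewrite andbF.
rewrite addn0 /Q eqxx /= finset.setUC.
have [->|uw1] := eqVneq u w1; first by rewrite adj_sym vw1 (negbTE w12) Q1 /= addn0.
have [->|uw2] := eqVneq u w2; first by rewrite adj_sym vw2 Q2.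
by rewrite andbF.
Qed.

(** The free predicate lets one count serve both for label classes and, with [predT], for
    degrees. *)
Let cnt (P : pred {set G}) (z : G) : nat :=
  \sum_(y : G) (adj z y && P [set z; y]).

Lemma cnt_inl P u : cnt P (inl u) = kept_degree P u +
  (if u == v then P [set inl v; inr S2] + P [set inl v; inr S3]
   else moved_degree P u).
Proof.
rewrite /cnt big_gadget_graph big_gadget /=; congr (_ + _).
rewrite /moved_degree; have [->|uv] := eqVneq u v.
  by rewrite ![v == _]eq_sym (negbTE w1v) (negbTE w2v) /= addn0.
rewrite !addn0 [[set inr T1; _]]finset.setUC [[set inr T2; _]]finset.setUC.
by do 2![case: eqP => [->|_] //=].
Qed.

Lemma cnt_inr P g : cnt P (inr g) =
  match g with
  | T1 => P [set inr T1; inl w1] + P [set inr T1; inr S1] + P [set inr T1; inr S3]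
  | T2 => P [set inr T2; inl w2] + P [set inr T2; inr S1] + P [set inr T2; inr S2]
  | S1 => P [set inr T1; inr S1] + P [set inr T2; inr S1] + P [set inr S1; inr Hub]
  | S2 => P [set inl v; inr S2] + P [set inr T2; inr S2] + P [set inr S2; inr Hub]
  | S3 => P [set inl v; inr S3] + P [set inr T1; inr S3] + P [set inr S3; inr Hub]
  | Hub => P [set inr S1; inr Hub] + P [set inr S2; inr Hub] + P [set inr S3; inr Hub]
  end.
Proof.
have C (a b : G) : P [set b; a] = P [set a; b] by rewrite finset.setUC.
rewrite /cnt big_gadget_graph big_gadget.
case: g => /=; rewrite ?addn0 ?add0n.
- by rewrite sum_pred1_and addnA.
- by rewrite sum_pred1_and addnA.
- by rewrite big1 // add0n (C (inr T1)) (C (inr T2)).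
- by rewrite sum_pred1_and (C (inl v)) (C (inr T2)) addnA.
- by rewrite sum_pred1_and (C (inl v)) (C (inr T1)) addnA.
- by rewrite big1 // add0n (C (inr S1)) (C (inr S2)) (C (inr S3)).
Qed.

Hypothesis wc : weak_labeling (gadget_negative v w1 w2 N) c.

Lemma contracted_degree_neq x u : u != v ->
  label_degree contracted_labeling x u = label_degree c x (inl u : G).
Proof.
move=> uv; rewrite contracted_degree label_degreeE.
by have := cnt_inl [pred f | c f == x] u; rewrite (negbTE uv) => <-.
Qed.

Lemma degree_neq u : u != v -> degree u = degree (inl u : G).
Proof.
move=> uv; rewrite (degree_labels contracted_labeling) (degree_labels c).
by rewrite !contracted_degree_neq.
Qed.

(** The two edges that [v] gives to [T1] and [T2] are replaced by its edges to [S2] and [S3]. *)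
Lemma degree_at_v : degree (inl v : G) = degree v.
Proof.
rewrite (degree_labels contracted_labeling) (degree_labels c).
rewrite !contracted_degree !label_degreeE.
have C x := cnt_inl [pred f | c f == x] v; rewrite /cnt /= in C.
rewrite !{}C /moved_degree eqxx /=.
case: (c _); case: (c _); case: (c _); case: (c _);
  by rewrite ?eqxx ?label_eqE /=; lia.
Qed.

(** All gadget vertices, [v] included, have odd degree: [lab0] occurs oddly at each, the other
    labels oddly exactly at the positive ones. *)
Let parity (l : label) (z : G) : v \in N -> odd (degree v) ->
  (if z is inl u then u == v else true) ->
  odd (cnt [pred f | c f == l] z) =
  (l == lab0) || (z \notin gadget_negative v w1 w2 N).
Proof.
move=> vN dv zG; have odd_z : odd (degree z).
  case: z zG => [u /eqP->|g _]; first by rewrite degree_at_v.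
  have -> : degree (inr g : G) = cnt predT (inr g).
    by rewrite degreeE; apply: eq_bigr => y _; rewrite andbT.
  by rewrite cnt_inr; case: g.
have cntE x : cnt [pred f | c f == x] z = label_degree c x z.
  by rewrite label_degreeE.
have /weak_labelingP/(_ z)[] := wc; rewrite cntE odd_z => d0 da db.
by case: l; rewrite ?d0 ?da ?db ?eqxx ?label_eqE.
Qed.

Lemma contracted_labeling_at_v : v \in N -> odd (degree v) ->
  [/\ odd (label_degree contracted_labeling lab0 v),
      ~~ odd (label_degree contracted_labeling laba v),
      ~~ odd (label_degree contracted_labeling labb v) &
      label_degree contracted_labeling lab0 v < degree v].
Proof.
move=> vN dv.
have pv l : odd (cnt [pred f | c f == l] (inl v)).
  by rewrite parity // inE eqxx andbF orbT.
have pg l g : odd (cnt [pred f | c f == l] (inr g)) =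
    (l == lab0) || (if g is (T1 | T2 | Hub) then true else false).
  by rewrite parity // inE; case: g.
have pT1 l := pg l T1; have pT2 l := pg l T2; have pS1 l := pg l S1.
have pS2 l := pg l S2; have pS3 l := pg l S3; have pHub l := pg l Hub.
rewrite {pg} in pT1 pT2 pS1 pS2 pS3 pHub.
have par l : odd (label_degree contracted_labeling l v) = (l == lab0).
  move: (pv l) (pT1 l) (pT2 l) (pS1 l) (pS2 l) (pS3 l) (pHub l).
  rewrite !cnt_inr cnt_inl contracted_degree /moved_degree eqxx /= !oddD !oddb.
  by rewrite !orbT !orbF; exact: gadget_parity.
split; rewrite ?par ?eqxx ?label_eqE //.
(* Suppose that after contraction all edges at [v] are labeled [lab0]; the labels inside the gadget
   are then forced one after another. *)
rewrite ltnNge; apply/negP => all0.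
have zero l : l != lab0 -> label_degree contracted_labeling l v = 0.
  move: all0; rewrite (degree_labels contracted_labeling).
  by case: l; rewrite ?eqxx //; lia.
have inner l : l != lab0 -> [/\ odd (cnt [pred f | c f == l] (inl v))
    = odd ((c [set inl v; inr S2] == l) + (c [set inl v; inr S3] == l)),
    (c [set inr T1; inl w1] == l) = false & (c [set inr T2; inl w2] == l) = false].
  move=> /zero; rewrite contracted_degree /moved_degree eqxx /= => /eqP.
  rewrite !addn_eq0 !eqb0 => /and3P[/eqP k0 /negbTE e1 /negbTE e2].
  by rewrite cnt_inl eqxx k0 e1 e2.
have [a0 b0] : laba != lab0 /\ labb != lab0 by rewrite !label_eqE.
have [ka e1a e2a] := inner _ a0; have [kb e1b e2b] := inner _ b0.
(* At each of [v], [T1], [T2] only the two hexagon edges can carry nonzero labels, so both do. *)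
move: (pv laba) (pv labb); rewrite ka kb => /two_nonzero/[apply] -[s2 s3].
move: (pT1 laba) (pT1 labb); rewrite !cnt_inr /= e1a e1b !add0n !orbT.
move=> /two_nonzero/[apply] -[a1 a3].
move: (pT2 laba) (pT2 labb); rewrite !cnt_inr /= e2a e2b !add0n !orbT.
move=> /two_nonzero/[apply] -[b1 b2].
(* Each negative [S] vertex now has two nonzero hexagon edges, hence a zero edge to [Hub]. *)
move: (pS1 laba) (pS1 labb); rewrite !cnt_inr /= !orbF.
move=> /(third_zero a1 b1)/[apply] h1.
move: (pS2 laba) (pS2 labb); rewrite !cnt_inr /= !orbF.
move=> /(third_zero s2 b2)/[apply] h2.
move: (pS3 laba) (pS3 labb); rewrite !cnt_inr /= !orbF.
move=> /(third_zero s3 a3)/[apply] h3.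
(* [Hub] is positive and needs an odd number of edges labeled [laba], but has none. *)
by move: (pHub laba); rewrite !cnt_inr /= h1 h2 h3 !label_eqE.
Qed.

Lemma contracted_labeling_weak : v \in N -> odd (degree v) ->
  weak_labeling N contracted_labeling.
Proof.
move=> vN dv; apply/weak_labelingP => u; have [->|uv] := eqVneq u v.
  have [d0 da db _] := contracted_labeling_at_v vN dv.
  by rewrite d0 (negbTE da) (negbTE db) dv vN.
have /weak_labelingP/(_ (inl u)) := wc.
by rewrite inE uv andbT !contracted_degree_neq // -degree_neq.
Qed.

End Labelings.

(** * Plane geometry *)

Section Planarity.
Variable R : realType.
Local Open Scope classical_set_scope.
Local Open Scope ring_scope.

(** Arcs may be given as a relation on ordered ends: choice selects one per edge and reversal
    repairs the orientation. A meeting point need only be some vertex, since [E_vertex] then makes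
    it an end of the edge. *)
Lemma planar_of_arcs (H : sgraph) (pt : H -> R * R)
    (E : H -> H -> set (R * R) -> Prop) :
  injective pt ->
  (forall x y, adj x y -> exists S, E x y S \/ E y x S) ->
  (forall x y S, E x y S -> plane_arc (pt x) (pt y) S) ->
  (forall x y S z, E x y S -> S (pt z) -> z = x \/ z = y) ->
  (forall x y S x' y' S' p, E x y S -> E x' y' S' ->
     [set x; y]%SET <> [set x'; y']%SET -> S p -> S' p -> exists z, p = pt z) ->
  planar R H.
Proof.
move=> pt_inj E_adj E_arc E_vertex E_meet.
have /boolp.choice[B BE] : forall f : {set H}, exists S, f \in edges H ->
    exists x y, f = [set x; y]%SET /\ E x y S.
  move=> f; have [/edgesP[x [y [xy ->]]]|fE] := boolP (f \in edges H); last first.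
    by exists set0.
  have [S [ES|ES]] := E_adj x y xy; exists S => _; first by exists x, y.
  by exists y, x; rewrite finset.setUC.
exists pt, B; split=> //.
- move=> x y xy; have [a [b [e Eab]]] := BE _ (mem_edges xy).
  have xye : x != y by apply: contraTneq xy => ->; rewrite adj_irrefl.
  have : x \in [set a; b]%SET by rewrite -e set21.
  have : y \in [set a; b]%SET by rewrite -e set22.
  have := E_arc _ _ _ Eab.
  rewrite !in_set2 => arc /orP[] /eqP ya /orP[] /eqP xa; subst.
  + by rewrite eqxx in xye.
  + exact: plane_arc_sym.
  + exact: arc.
  + by rewrite eqxx in xye.
- move=> f z /BE[x [y [-> Exy]]] /(E_vertex _ _ _ _ Exy)[]->; first exact: set21.
  exact: set22.
- move=> f g p /BE[x [y [ef Exy]]] /BE[x' [y' [eg Exy']]] /eqP fg fp gp.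
  have [|z pz] := E_meet _ _ _ _ _ _ _ Exy Exy' _ fp gp; first by rewrite -ef -eg.
  exists z => //; rewrite ef; move: fp; rewrite pz => /(E_vertex _ _ _ _ Exy)[]->.
    exact: set21.
  exact: set22.
Qed.

(** The squared length of the sum of the three vectors is nonnegative and at most 3[r] + 6[d]. *)
Lemma dot_lower_bound (r d x1 y1 x2 y2 x3 y3 : R) :
  x1 ^+ 2 + y1 ^+ 2 = r -> x2 ^+ 2 + y2 ^+ 2 = r -> x3 ^+ 2 + y3 ^+ 2 = r ->
  x1 * x2 + y1 * y2 = d -> x1 * x3 + y1 * y3 <= d -> x2 * x3 + y2 * y3 <= d ->
  - r <= 2 * d.
Proof.
move=> h1 h2 h3 h12 h13 h23.
have := addr_ge0 (sqr_ge0 (x1 + x2 + x3)) (sqr_ge0 (y1 + y2 + y3)).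
by rewrite !expr2 in h1 h2 h3 *; lra.
Qed.

Lemma dot_upper_bound (r x1 y1 x2 y2 : R) :
  x1 ^+ 2 + y1 ^+ 2 = r -> x2 ^+ 2 + y2 ^+ 2 = r -> (x1, y1) != (x2, y2) ->
  x1 * x2 + y1 * y2 < r.
Proof.
move=> h1 h2; rewrite xpair_eqE negb_and => ne.
have : 0 < (x1 - x2) ^+ 2 + (y1 - y2) ^+ 2.
  case/orP: ne => ne.
    by rewrite ltr_wpDr ?sqr_ge0 // exprn_even_gt0 //= subr_eq0.
  by rewrite ltr_wpDl ?sqr_ge0 // exprn_even_gt0 //= subr_eq0.
by rewrite !expr2 in h1 h2 *; lra.
Qed.

(** The Gram determinant ([r] - [d])([r] + [d]) of the two vectors is nonzero. *)
Lemma lin_indep (r d x1 y1 x2 y2 a b : R) :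
  0 < r -> - r <= 2 * d -> d < r ->
  x1 ^+ 2 + y1 ^+ 2 = r -> x2 ^+ 2 + y2 ^+ 2 = r -> x1 * x2 + y1 * y2 = d ->
  a * x1 + b * x2 = 0 -> a * y1 + b * y2 = 0 -> a = 0 /\ b = 0.
Proof.
move=> r0 dl du h1 h2 h12 e1 e2.
have f1 : a * r + b * d = 0.
  rewrite -h1 -h12; transitivity ((a * x1 + b * x2) * x1 + (a * y1 + b * y2) * y1).
    by ring.
  by rewrite e1 e2 !mul0r addr0.
have f2 : a * d + b * r = 0.
  rewrite -h2 -h12; transitivity ((a * x1 + b * x2) * x2 + (a * y1 + b * y2) * y2).
    by ring.
  by rewrite e1 e2 !mul0r addr0.
have k0 : (r - d) * (r + d) != 0 by rewrite mulf_neq0 //; apply/lt0r_neq0; lra.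
split; apply: (mulIf k0); rewrite mul0r.
  transitivity ((a * r + b * d) * r - (a * d + b * r) * d); first by ring.
  by rewrite f1 f2 !mul0r subrr.
transitivity ((a * d + b * r) * r - (a * r + b * d) * d); first by ring.
by rewrite f1 f2 !mul0r subrr.
Qed.

(* If [d] is the largest inner product among unit directions, no third
   direction lies in the cone spanned by the two directions realizing it. *)
Lemma cone_empty (r d x1 y1 x2 y2 x3 y3 a b t : R) :
  0 < r -> - r <= 2 * d -> d < r ->
  x1 ^+ 2 + y1 ^+ 2 = r -> x2 ^+ 2 + y2 ^+ 2 = r -> x3 ^+ 2 + y3 ^+ 2 = r ->
  x1 * x2 + y1 * y2 = d -> x1 * x3 + y1 * y3 <= d -> x2 * x3 + y2 * y3 <= d ->
  0 <= a -> 0 <= b -> 0 <= t ->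
  a * x1 + b * x2 = t * x3 -> a * y1 + b * y2 = t * y3 -> t = 0.
Proof.
move=> r0 dl du h1 h2 h3 h12 h13 h23 a0 b0 t0 e1 e2.
apply/eqP; rewrite eq_le t0 andbT leNgt; apply/negP => tp.
set d1 := x1 * x3 + y1 * y3 in h13; set d2 := x2 * x3 + y2 * y3 in h23.
(* The three identities are the inner products of the cone relation with the first, second and third
   vector. *)
have f1 : a * r + b * d = t * d1.
  rewrite -h1 -h12 /d1.
  transitivity ((a * x1 + b * x2) * x1 + (a * y1 + b * y2) * y1); first by ring.
  by rewrite e1 e2; ring.
have f2 : a * d + b * r = t * d2.
  rewrite -h2 -h12 /d2.
  transitivity ((a * x1 + b * x2) * x2 + (a * y1 + b * y2) * y2); first by ring.
  by rewrite e1 e2; ring.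
have f3 : a * d1 + b * d2 = t * r.
  rewrite -h3 /d1 /d2.
  transitivity ((a * x1 + b * x2) * x3 + (a * y1 + b * y2) * y3); first by ring.
  by rewrite e1 e2; ring.
have g1 : t * r <= (a + b) * d.
  by rewrite -f3 mulrDl lerD // ler_wpM2l.
have g2 : (a + b) * (r + d) <= 2 * (t * d).
  have := lerD (ler_wpM2l t0 h13) (ler_wpM2l t0 h23); rewrite -f1 -f2.
  by rewrite mulrDl !mulrDr; lra.
have d0 : 0 < d.
  have : 0 < (a + b) * d by apply: lt_le_trans g1; apply: mulr_gt0.
  have ab0 : 0 <= a + b by apply: addr_ge0.
  by rewrite ltNge => abd; rewrite ltNge; apply: contra abd => d0; apply: mulr_ge0_le0.
(* Eliminating [a + b] between [g1] and [g2] contradicts the positivity of [t]([r] - [d])([r] +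
   2[d]). *)
have g3 : t * r * (r + d) <= 2 * (t * d) * d.
  apply: (@le_trans _ _ ((a + b) * (r + d) * d)).
    by rewrite [leRHS]mulrAC ler_wpM2r //; lra.
  by rewrite ler_wpM2r // ltW.
have : 0 < t * ((r - d) * (r + 2 * d)).
  by apply: mulr_gt0 => //; apply: mulr_gt0; lra.
by lra.
Qed.

Lemma exists_pos_bound (T : finType) (P : T -> R -> Prop) :
  (forall i, exists2 e, 0 < e & forall e', 0 < e' -> e' <= e -> P i e') ->
  exists2 e, 0 < e & forall i e', 0 < e' -> e' <= e -> P i e'.
Proof.
move=> Pe; have /boolp.choice[e eP] : forall i, exists e, 0 < e /\
    forall e', 0 < e' -> e' <= e -> P i e'.
  by move=> i; have [e e0 eP] := Pe i; exists e.
exists (\big[Num.min/1]_i e i).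
  by apply: lt_bigmin => // i _; have [] := eP i.
move=> i e' e'0 e'le; have [_] := eP i; apply=> //.
by apply: le_trans e'le _; apply: bigmin_le_cond.
Qed.

(** * Squared distance and a disc isolating a vertex *)

Definition dist2 (c p : R * R) : R := (p.1 - c.1) ^+ 2 + (p.2 - c.2) ^+ 2.

Lemma dist2_continuous c : continuous (dist2 c).
Proof.
move=> p.
have c1 : {for p, continuous (fun p : R * R => p.1 - c.1)}.
  by apply: cvgB; [exact: cvg_fst|exact: cvg_cst].
have c2 : {for p, continuous (fun p : R * R => p.2 - c.2)}.
  by apply: cvgB; [exact: cvg_snd|exact: cvg_cst].
exact: cvgD (cvgM c1 c1) (cvgM c2 c2).
Qed.

Lemma dist2_gt0 c p : p != c -> 0 < dist2 c p.
Proof.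
rewrite [p]surjective_pairing [c]surjective_pairing xpair_eqE negb_and /dist2 /=.
case/orP=> ne.
  by rewrite ltr_wpDr ?sqr_ge0 // exprn_even_gt0 //= subr_eq0.
by rewrite ltr_wpDl ?sqr_ge0 // exprn_even_gt0 //= subr_eq0.
Qed.

Lemma dist2_self c : dist2 c c = 0.
Proof. by rewrite /dist2 !subrr expr0n addr0. Qed.

(** The other vertices are finitely many points and the edges missing [v] finitely many compact
    sets, all at positive distance from [v]. The number [r] is a squared radius. *)
Lemma exists_radius (H : sgraph) (v : H) pt A : @plane_drawing R H pt A ->
  exists2 r : R, 0 < r &
    (forall u, u != v -> r < dist2 (pt v) (pt u)) /\
    (forall f p, f \in edges H -> v \notin f -> A f p -> r < dist2 (pt v) p).
Proof.
case=> pt_inj Aarc Avertex _.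
have [r1 r10 r1P] : exists2 e, 0 < e & forall u e', 0 < e' -> e' <= e ->
    u != v -> e' < dist2 (pt v) (pt u).
  apply: (exists_pos_bound (P := fun u e => u != v -> e < dist2 (pt v) (pt u))).
  move=> u; have [->|uv] := eqVneq u v; first by exists 1.
  have : 0 < dist2 (pt v) (pt u) by rewrite dist2_gt0 // (inj_eq pt_inj).
  by move=> d0; exists (dist2 (pt v) (pt u) / 2) => [|e' _ e'le _]; lra.
have [r2 r20 r2P] : exists2 e, 0 < e & forall f e', 0 < e' -> e' <= e ->
    f \in edges H -> v \notin f -> forall p, A f p -> e' < dist2 (pt v) p.
  apply: (exists_pos_bound (P := fun f e => f \in edges H -> v \notin f ->
    forall p, A f p -> e < dist2 (pt v) p)).
  move=> f; have [|nf] := boolP ((f \in edges H) && (v \notin f)); last first.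
    by exists 1 => // e' _ _ fE vf; rewrite fE vf in nf.
  case/andP=> fE vf; have [x [y [xy ef]]] := edgesP _ fE.
  have arc := Aarc _ _ xy; rewrite -ef in arc.
  have A0 : A f !=set0.
    by case: arc => g [_ _ _ _ ->]; exists (g 0), 0; rewrite //= in_itv /= lexx ler01.
  have [||p0 /set_mem Ap0 p0P] := @compact_EVT_min _ R (dist2 (pt v)) _ A0.
  - exact: plane_arc_compact arc.
  - by apply: continuous_subspaceT; exact: dist2_continuous.
  have d0 : 0 < dist2 (pt v) p0.
    apply: dist2_gt0; apply: contraNneq vf => e; apply: Avertex => //.
    by rewrite -e.
  exists (dist2 (pt v) p0 / 2); first by lra.
  by move=> e' _ e'le _ _ p /mem_set/p0P; lra.
have m1 : Num.min r1 r2 <= r1 by rewrite ge_min lexx.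
have m2 : Num.min r1 r2 <= r2 by rewrite ge_min lexx orbT.
have m0 : 0 < Num.min r1 r2 by rewrite lt_min r10.
exists (Num.min r1 r2) => //; split=> [u|f p]; first exact: r1P.
by move=> *; apply: r2P; eassumption.
Qed.

End Planarity.

(** * Drawing the gadget *)

Section Drawing.
Variable R : realType.
Local Open Scope classical_set_scope.
Local Open Scope ring_scope.

Definition segment (p q : R * R) : set (R * R) :=
  [set z | exists2 t : R, 0 <= t <= 1 &
    z = (p.1 + t * (q.1 - p.1), p.2 + t * (q.2 - p.2))].

(* [None] stands for the vertex [v], which is the third corner of the triangle
   in which the gadget is drawn. *)
Definition gadget_coord (g : option gadget) : R * R :=
  match g with
  | None => (0, 0)
  | Some T1 => (1, 0)
  | Some T2 => (0, 1)
  | Some S1 => (1/2, 1/2)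
  | Some S2 => (0, 1/2)
  | Some S3 => (1/2, 0)
  | Some Hub => (1/3, 1/3)
  end.

(** Each edge is listed in one orientation only, so different pairs are different edges. *)
Definition inner_edge (g h : option gadget) : bool :=
  match g, h with
  | None, Some S2 | None, Some S3
  | Some T1, Some S1 | Some T1, Some S3 | Some T2, Some S1 | Some T2, Some S2
  | Some S1, Some Hub | Some S2, Some Hub | Some S3, Some Hub => true
  | _, _ => false
  end.

Lemma gadget_coord_inj : injective gadget_coord.
Proof. by case=> [[]|] [[]|] //= [] *; exfalso; lra. Qed.

Lemma gadget_coord_triangle g :
  [/\ 0 <= (gadget_coord g).1, 0 <= (gadget_coord g).2 &
      (gadget_coord g).1 + (gadget_coord g).2 <= 1].
Proof. by case: g => [[]|] /=; split; lra. Qed.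

Lemma inner_vertex g h k (t : R) : inner_edge g h -> 0 <= t <= 1 ->
  (gadget_coord k).1 = (gadget_coord g).1 + t * ((gadget_coord h).1 - (gadget_coord g).1) ->
  (gadget_coord k).2 = (gadget_coord g).2 + t * ((gadget_coord h).2 - (gadget_coord g).2) ->
  k = g \/ k = h.
Proof.
by case: g => [[]|]; case: h => [[]|] // _ /andP[t0 t1]; case: k => [[]|] /= e1 e2;
  (by left) || (by right) || (exfalso; lra).
Qed.

(** The coordinates are explicit: for each pair of edges, linear arithmetic either refutes a meeting
    or identifies it with a corner. *)
Lemma inner_meet g h g' h' (t s x y : R) :
  inner_edge g h -> inner_edge g' h' -> (g, h) <> (g', h') ->
  0 <= t <= 1 -> 0 <= s <= 1 ->
  x = (gadget_coord g).1 + t * ((gadget_coord h).1 - (gadget_coord g).1) ->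
  y = (gadget_coord g).2 + t * ((gadget_coord h).2 - (gadget_coord g).2) ->
  x = (gadget_coord g').1 + s * ((gadget_coord h').1 - (gadget_coord g').1) ->
  y = (gadget_coord g').2 + s * ((gadget_coord h').2 - (gadget_coord g').2) ->
  exists k, (x, y) = gadget_coord k.
Proof.
have vertex k : x = (gadget_coord k).1 -> y = (gadget_coord k).2 ->
    exists k, (x, y) = gadget_coord k.
  by move=> -> ->; exists k; rewrite -surjective_pairing.
case: g => [[]|]; case: h => [[]|] // _; case: g' => [[]|]; case: h' => [[]|] // _ ne;
  (try by case: ne) => /andP[t0 t1] /andP[s0 s1] /= e1 e2 e3 e4 {ne};
  first [ (exfalso; lra)
        | (apply: (vertex None) => /=; lra) | (apply: (vertex (Some S1)) => /=; lra)
        | (apply: (vertex (Some Hub)) => /=; lra)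
        | (apply: (vertex (Some S2)) => /=; lra) | (apply: (vertex (Some S3)) => /=; lra)
        | (apply: (vertex (Some T1)) => /=; lra) | (apply: (vertex (Some T2)) => /=; lra) ].
Qed.

Variables (H : sgraph) (v : H) (pt : H -> R * R) (A : {set H} -> set (R * R)).
(* [q w] is the point where the edge from [v] to [w] last leaves the disc of
   squared radius [r] around [v], and [tail w] is the rest of that edge. *)
Variables (r : R) (q : H -> R * R) (tail : H -> set (R * R)) (w1 w2 w3 : H).

Let c := pt v.
Let rho := dist2 c.
Let dot (w w' : H) : R :=
  ((q w).1 - c.1) * ((q w').1 - c.1) + ((q w).2 - c.2) * ((q w').2 - c.2).

Hypothesis drawing : plane_drawing pt A.
Hypothesis r_gt0 : 0 < r.
Hypothesis far_vertex : forall u, u != v -> r < rho (pt u).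
Hypothesis far_edge : forall f p, f \in edges H -> v \notin f -> A f p -> r < rho p.
Hypothesis tailP : forall w, adj v w ->
  [/\ plane_arc (q w) (pt w) (tail w), tail w `<=` A [set v; w]%SET, tail w (q w),
      rho (q w) = r & forall z, tail w z -> z = q w \/ r < rho z].
Hypotheses (vw1 : adj v w1) (vw2 : adj v w2) (vw3 : adj v w3).
Hypotheses (w12 : w1 != w2) (w31 : w3 != w1) (w32 : w3 != w2).
Hypothesis dot_max : forall w w', adj v w -> adj v w' -> w != w' ->
  dot w w' <= dot w1 w2.

Let d := dot w1 w2.
Let G := gadget_graph v w1 w2.

Let adj_neq w : adj v w -> w != v.
Proof. by apply: contraTneq => ->; rewrite adj_irrefl. Qed.

Let norm_q w : adj v w -> ((q w).1 - c.1) ^+ 2 + ((q w).2 - c.2) ^+ 2 = r.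
Proof. by case/tailP. Qed.

Lemma outer_meet a b a' b' p : adj a b -> adj a' b' ->
  [set a; b]%SET != [set a'; b']%SET -> A [set a; b]%SET p -> A [set a'; b']%SET p ->
  r <= rho p -> exists2 z, z != v & p = pt z.
Proof.
move=> ab ab' ne Ap Ap' rp; have [_ _ _ meet] := drawing.
have [z _ pz] := meet _ _ _ (mem_edges ab) (mem_edges ab') ne Ap Ap'.
exists z => //; apply: contraTneq rp => zv.
by rewrite pz zv /rho dist2_self -ltNge.
Qed.

(** A shared exit point would lie on two edges, hence be a vertex other than [v] on the circle,
    whereas all of these lie strictly outside. *)
Lemma exit_inj w w' : adj v w -> adj v w' -> q w = q w' -> w = w'.
Proof.
move=> vw vw' e; apply/eqP; apply: contraT => ne.
have [arc Aw qw rq _] := tailP vw; have [_ Aw' qw' _ _] := tailP vw'.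
have [||||z zv qz] := @outer_meet v w v w' (q w) vw vw'.
- by apply: contra ne => /eqP/set2_injr->.
- exact: Aw.
- by rewrite e; exact: Aw'.
- by rewrite rq.
by have := far_vertex zv; rewrite -qz rq ltxx.
Qed.

Let d_upper : d < r.
Proof.
apply: (dot_upper_bound (norm_q vw1) (norm_q vw2)).
apply: contra w12 => /eqP [] /addIr e1 /addIr e2; apply/eqP/exit_inj => //.
by rewrite [q w1]surjective_pairing e1 e2 -surjective_pairing.
Qed.

Let d_lower : - r <= 2 * d.
Proof.
apply: (dot_lower_bound (norm_q vw1) (norm_q vw2) (norm_q vw3)) => //.
  by apply: dot_max => //; rewrite eq_sym.
by apply: dot_max => //; rewrite eq_sym.
Qed.

(** The affine map from the model triangle to the one with corners [c], [q w1], [q w2]. *)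
Let tri (a b : R) : R * R :=
  (c.1 + a * ((q w1).1 - c.1) + b * ((q w2).1 - c.1),
   c.2 + a * ((q w1).2 - c.2) + b * ((q w2).2 - c.2)).

Lemma triangle_inj a b a' b' : tri a b = tri a' b' -> a = a' /\ b = b'.
Proof.
move=> [e1 e2].
have [||] := @lin_indep _ r d _ _ _ _ (a - a') (b - b') r_gt0 d_lower d_upper
  (norm_q vw1) (norm_q vw2) erefl.
- by rewrite !mulrBl; lra.
- by rewrite !mulrBl; lra.
by move=> /eqP; rewrite subr_eq0 => /eqP-> /eqP; rewrite subr_eq0 => /eqP->.
Qed.

Lemma triangle_dist a b : rho (tri a b) = (a ^+ 2 + b ^+ 2) * r + 2 * (a * b) * d.
Proof.
rewrite /rho /dist2 /= mulrDl -{1}(norm_q vw1) -(norm_q vw2) /d /dot.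
by ring.
Qed.

(** The squared distance is ([a] + [b])^2 [r] - 2 [a] [b] ([r] - [d]), so only the two exit points
    lie on the circle. *)
Lemma triangle_in_disc a b : 0 <= a -> 0 <= b -> a + b <= 1 ->
  rho (tri a b) < r \/
  tri a b = q w1 /\ (a, b) = (1, 0) \/ tri a b = q w2 /\ (a, b) = (0, 1).
Proof.
move=> a0 b0 ab; rewrite triangle_dist.
have [/eqP b00|bp] := boolP (b == 0).
  have [/eqP a1|a1] := boolP (a == 1).
    right; left; rewrite a1 b00 /tri !mul1r !mul0r !addr0 !subrKC.
    by rewrite -surjective_pairing.
  left; have al : a < 1 by rewrite lt_neqAle a1; lra.
  rewrite b00 mulr0 mulr0 mul0r addr0 expr0n /= addr0.
  have : a ^+ 2 < 1 by rewrite expr_lt1.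
  by move=> h; rewrite -[ltRHS]mul1r ltr_pM2r.
have [/eqP a00|ap] := boolP (a == 0).
  have [/eqP b1|b1] := boolP (b == 1).
    right; right; rewrite b1 a00 /tri !mul1r !mul0r !addr0 !subrKC.
    by rewrite -surjective_pairing.
  left; have bl : b < 1 by rewrite lt_neqAle b1; lra.
  rewrite a00 mul0r mulr0 mul0r addr0 expr0n /= add0r.
  have : b ^+ 2 < 1 by rewrite expr_lt1.
  by move=> h; rewrite -[ltRHS]mul1r ltr_pM2r.
left.
have abp : 0 < a * b by rewrite mulr_gt0 // lt_neqAle eq_sym ?ap ?bp.
have h1 : a * b * d < a * b * r by rewrite ltr_pM2l.
have h2 : (a + b) ^+ 2 * r <= r.
  rewrite -[leRHS]mul1r ler_pM2r // expr_le1 ?addr_ge0 //.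
have -> : (a ^+ 2 + b ^+ 2) * r = (a + b) ^+ 2 * r - 2 * (a * b * r) by ring.
by rewrite -[2 * (a * b) * d]mulrA; lra.
Qed.

Lemma triangle_cone w a b t : adj v w -> w != w1 -> w != w2 ->
  0 <= a -> 0 <= b -> 0 <= t ->
  tri a b = (c.1 + t * ((q w).1 - c.1), c.2 + t * ((q w).2 - c.2)) ->
  a = 0 /\ b = 0.
Proof.
move=> vw ww1 ww2 a0 b0 t0 e.
have t00 : t = 0.
  case: e => e1 e2.
  apply: (@cone_empty _ r d _ _ _ _ _ _ a b t r_gt0 d_lower d_upper
    (norm_q vw1) (norm_q vw2) (norm_q vw) erefl) => //; try lra.
    by apply: dot_max => //; rewrite eq_sym.
  by apply: dot_max => //; rewrite eq_sym.
apply: triangle_inj; rewrite e t00 /tri !mul0r !addr0 //.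
Qed.

(** * Points and arcs of the new drawing *)

Definition gadget_point (z : G) : R * R :=
  match z with
  | inl x => pt x
  | inr g => tri (gadget_coord (Some g)).1 (gadget_coord (Some g)).2
  end.

Definition corner (g : option gadget) : G :=
  if g is Some g then inr g else inl v.

Lemma corner_inj : injective corner.
Proof. by case=> [g|] [h|] //= [->]. Qed.

Lemma cornerE g :
  gadget_point (corner g) = tri (gadget_coord g).1 (gadget_coord g).2.
Proof.
case: g => //=; rewrite /tri !mul0r !addr0 -surjective_pairing //.
Qed.

(** [T1] and [T2] sit at the exit points of the moved edges, so the bare tails serve for these; the
    kept edges at [v] need a radius as well. *)
Variant gadget_arc : G -> G -> set (R * R) -> Prop :=
| OuterArc a b of a != v & b != v & adj a b :
    gadget_arc (inl a) (inl b) (A [set a; b]%SET)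
| RadialArc w of adj v w & w != w1 & w != w2 :
    gadget_arc (inl v) (inl w) (segment c (q w) `|` tail w)
| TailArc1 : gadget_arc (inr T1) (inl w1) (tail w1)
| TailArc2 : gadget_arc (inr T2) (inl w2) (tail w2)
| InnerArc g h of inner_edge g h :
    gadget_arc (corner g) (corner h)
      (segment (gadget_point (corner g)) (gadget_point (corner h))).

Lemma corner_segment g h p :
  segment (gadget_point (corner g)) (gadget_point (corner h)) p ->
  exists t, [/\ 0 <= t <= 1,
    p = tri ((gadget_coord g).1 + t * ((gadget_coord h).1 - (gadget_coord g).1))
            ((gadget_coord g).2 + t * ((gadget_coord h).2 - (gadget_coord g).2)),
    0 <= (gadget_coord g).1 + t * ((gadget_coord h).1 - (gadget_coord g).1),
    0 <= (gadget_coord g).2 + t * ((gadget_coord h).2 - (gadget_coord g).2) &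
    (gadget_coord g).1 + t * ((gadget_coord h).1 - (gadget_coord g).1) +
    ((gadget_coord g).2 + t * ((gadget_coord h).2 - (gadget_coord g).2)) <= 1].
Proof.
rewrite !cornerE => -[t t01 ->]; exists t.
have [a0 b0 ab] := gadget_coord_triangle g.
have [a0' b0' ab'] := gadget_coord_triangle h.
have /andP[t0 t1] := t01; split; [exact: t01| |nra|nra|nra].
by rewrite /tri /=; congr (_, _); ring.
Qed.

Lemma inner_arc_disc g h p :
  segment (gadget_point (corner g)) (gadget_point (corner h)) p ->
  [\/ rho p < r, p = q w1 /\ p = gadget_point (inr T1) |
      p = q w2 /\ p = gadget_point (inr T2)].
Proof.
case/corner_segment => t [t01 -> a0 b0 ab].
have [|[[e1 [e2 e3]]|[e1 [e2 e3]]]] := triangle_in_disc a0 b0 ab.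
- by constructor 1.
- by constructor 2; rewrite e1; split=> //; rewrite /= -e1 e2 e3.
- by constructor 3; rewrite e1; split=> //; rewrite /= -e1 e2 e3.
Qed.

(** * Position of the arcs relative to the disc *)

Lemma radial_segment w p : adj v w -> segment c (q w) p ->
  p = q w \/ rho p < r.
Proof.
move=> vw [t /andP[t0 t1] ->].
have [->|tn] := eqVneq t 1.
  by left; rewrite !mul1r !subrKC -surjective_pairing.
right; rewrite /rho /dist2 /= [c.1 + _ - _]addrAC [c.2 + _ - _]addrAC !subrr !add0r.
have -> : (t * ((q w).1 - c.1)) ^+ 2 + (t * ((q w).2 - c.2)) ^+ 2 = t ^+ 2 * r.
  by rewrite -(norm_q vw); ring.
by rewrite -[ltRHS]mul1r ltr_pM2r // expr_lt1 // lt_neqAle tn.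
Qed.

Lemma radial_meet w w' p : adj v w -> adj v w' -> w != w' ->
  segment c (q w) p -> segment c (q w') p -> p = c.
Proof.
move=> vw vw' ww' [t /andP[t0 t1] ->] [s /andP[s0 s1] [/addrI e1 /addrI e2]].
(* Both sides have the same squared distance from [c], and the parameters are nonnegative. *)
have ts : t = s.
  have : t ^+ 2 * r = s ^+ 2 * r.
    rewrite -{1}(norm_q vw) -(norm_q vw') !mulrDr -!exprMn.
    by rewrite e1 e2.
  by move/(mulIf (lt0r_neq0 r_gt0))/eqP; rewrite eqrXn2 // => /eqP.
have [t00|tn] := eqVneq t 0; first by rewrite t00 !mul0r !addr0 -surjective_pairing.
exfalso; move: ww' => /negP; apply; apply/eqP/exit_inj => //.
rewrite -ts in e1 e2; have /addIr f1 := mulfI tn e1; have /addIr f2 := mulfI tn e2.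
by rewrite [q w]surjective_pairing f1 f2 -surjective_pairing.
Qed.

Lemma tail_far w p : adj v w -> tail w p -> r <= rho p.
Proof.
move=> vw; have [_ _ _ rq far] := tailP vw.
by move=> /far[->|/ltW//]; rewrite rq.
Qed.

Lemma tail_edge w p : adj v w -> tail w p -> A [set v; w]%SET p.
Proof. by move=> vw; have [_ sub _ _ _] := tailP vw; exact: sub. Qed.

Lemma tail_disc w p : adj v w -> tail w p -> rho p <= r -> p = q w.
Proof.
move=> vw; have [_ _ _ _ far] := tailP vw.
by move=> /far[//|]; rewrite ltNge => /negbTE->.
Qed.

Lemma inner_arc_close g h p :
  segment (gadget_point (corner g)) (gadget_point (corner h)) p -> rho p <= r.
Proof.
have [_ _ _ r1 _] := tailP vw1; have [_ _ _ r2 _] := tailP vw2.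
by case/inner_arc_disc => [/ltW//|[-> _]|[-> _]]; rewrite (r1, r2).
Qed.

Lemma inner_arc_rim g h p :
  segment (gadget_point (corner g)) (gadget_point (corner h)) p -> r <= rho p ->
  exists z, p = gadget_point z.
Proof.
case/inner_arc_disc => [|[_ ->]|[_ ->]] //; last 2 first.
- by exists (inr T1).
- by exists (inr T2).
by rewrite ltNge => /negbTE->.
Qed.

Lemma radial_close w p : adj v w -> segment c (q w) p -> rho p <= r.
Proof.
move=> vw; have [_ _ _ rq _] := tailP vw.
by move=> /(radial_segment vw)[->|/ltW//]; rewrite rq.
Qed.

Lemma radial_rim w p : adj v w -> segment c (q w) p -> r <= rho p -> p = q w.
Proof.
by move=> vw /(radial_segment vw)[//|]; rewrite ltNge => /negbTE->.
Qed.

Lemma outer_vertex a b a' b' p : adj a b -> adj a' b' ->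
  [set a; b]%SET != [set a'; b']%SET -> A [set a; b]%SET p -> A [set a'; b']%SET p ->
  r <= rho p -> exists z, p = gadget_point z.
Proof.
move=> ab ab' ne Ap Ap' rp; have [z _ ->] := outer_meet ab ab' ne Ap Ap' rp.
by exists (inl z).
Qed.

Lemma outer_arc_far a b p : a != v -> b != v -> adj a b ->
  A [set a; b]%SET p -> r < rho p.
Proof.
move=> av bv ab; apply: far_edge; first exact: mem_edges.
by rewrite in_set2 negb_or ![v == _]eq_sym av bv.
Qed.

(** * Pairwise intersections of the arcs *)

Lemma meet_outer a b x y S p : a != v -> b != v -> adj a b -> gadget_arc x y S ->
  [set inl a; inl b]%SET <> [set x; y]%SET -> A [set a; b]%SET p -> S p ->
  exists z, p = gadget_point z.
Proof.
move=> av bv ab; have rp := outer_arc_far av bv ab.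
have nev w : [set a; b]%SET != [set v; w]%SET.
  apply/eqP => e; have : v \in [set a; b]%SET by rewrite e set21.
  by rewrite in_set2 ![v == _]eq_sym (negbTE av) (negbTE bv).
case=> [a' b' av' bv' ab'|w vw ww1 ww2|||g h gh] ne Ap Sp.
- apply: (outer_vertex ab ab' _ Ap Sp); last exact/ltW/rp.
  apply/eqP => e; apply: ne.
  by rewrite -!(imset_set1 inl) -!imsetU e.
- case: Sp => Sp.
    by have := rp _ Ap; rewrite ltNge (radial_close vw Sp).
  by apply: (outer_vertex ab vw (nev _) Ap (tail_edge vw Sp)); exact/ltW/rp.
- by apply: (outer_vertex ab vw1 (nev _) Ap (tail_edge vw1 Sp)); exact/ltW/rp.
- by apply: (outer_vertex ab vw2 (nev _) Ap (tail_edge vw2 Sp)); exact/ltW/rp.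
- by have := rp _ Ap; rewrite ltNge (inner_arc_close Sp).
Qed.

(** A tail meets the closed disc only at its exit point, which differs from the other exit point;
    two tails meet only where the old edges do. *)
Lemma meet_tail w w' p : adj v w -> adj v w' -> w != w' ->
  tail w p -> (segment c (q w') `|` tail w') p -> exists z, p = gadget_point z.
Proof.
move=> vw vw' ww' Sp [Sp'|Sp'].
  have rp := tail_far vw Sp.
  have e := tail_disc vw Sp (radial_close vw' Sp').
  exfalso; move: ww' => /negP; apply; apply/eqP/exit_inj => //.
  by rewrite -e; exact: radial_rim Sp' rp.
apply: (outer_vertex vw vw' _ (tail_edge vw Sp) (tail_edge vw' Sp')).
  by apply: contra ww' => /eqP/set2_injr->.
exact: tail_far Sp.
Qed.

Lemma meet_radial w x y S p : adj v w -> w != w1 -> w != w2 -> gadget_arc x y S ->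
  [set inl v; inl w]%SET <> [set x; y]%SET -> (segment c (q w) `|` tail w) p -> S p ->
  exists z, p = gadget_point z.
Proof.
move=> vw ww1 ww2; case=> [a b av bv ab|w' vw' ww1' ww2'|||g h gh] ne Sp Sp'.
- apply: (meet_outer av bv ab (RadialArc vw ww1 ww2) _ Sp' Sp).
  by move=> e; apply: ne.
- have ww' : w != w' by apply/eqP => e; apply: ne; rewrite e.
  case: Sp => Sp; last exact: meet_tail Sp Sp'.
  case: Sp' => Sp'; first by exists (inl v); exact: radial_meet Sp Sp'.
  by apply: (@meet_tail w' w) => //; [rewrite eq_sym|left].
- by apply: (@meet_tail w1 w) => //; rewrite eq_sym.
- by apply: (@meet_tail w2 w) => //; rewrite eq_sym.
- case: Sp => Sp; last by apply: (inner_arc_rim Sp'); exact: tail_far Sp.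
  (* A radius and a segment in the triangle can meet only at [c], because no third exit direction
     lies in the cone. *)
  have [t [_ ep a0 b0 _]] := corner_segment Sp'.
  case: Sp => s /andP[s0 _] ep'; rewrite ep in ep'.
  have [ea eb] := triangle_cone vw ww1 ww2 a0 b0 s0 ep'.
  by exists (inl v); rewrite ep ea eb /tri !mul0r !addr0 -surjective_pairing.
Qed.

Lemma gadget_arc_meet x y S x' y' S' p :
  gadget_arc x y S -> gadget_arc x' y' S' -> [set x; y]%SET <> [set x'; y']%SET ->
  S p -> S' p -> exists z, p = gadget_point z.
Proof.
move=> E E'; case: E (E) => [a b av bv ab|w vw ww1 ww2|||g h gh] E ne Sp Sp'.
- exact: meet_outer av bv ab E' ne Sp Sp'.
- exact: meet_radial vw ww1 ww2 E' ne Sp Sp'.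
- case: E' ne Sp' => [a b av bv ab|w vw ww1 ww2|||g h gh] ne Sp'.
  + by apply: (meet_outer av bv ab E _ Sp' Sp) => e; apply: ne.
  + by apply: (meet_radial vw ww1 ww2 E _ Sp' Sp) => e; apply: ne.
  + by [].
  + by apply: (meet_tail vw1 vw2 w12 Sp); right.
  + by apply: (inner_arc_rim Sp'); exact: tail_far Sp.
- case: E' ne Sp' => [a b av bv ab|w vw ww1 ww2|||g h gh] ne Sp'.
  + by apply: (meet_outer av bv ab E _ Sp' Sp) => e; apply: ne.
  + by apply: (meet_radial vw ww1 ww2 E _ Sp' Sp) => e; apply: ne.
  + by apply: (meet_tail vw1 vw2 w12 Sp'); right.
  + by [].
  + by apply: (inner_arc_rim Sp'); exact: tail_far Sp.
- case: E' ne Sp' => [a b av bv ab|w vw ww1 ww2|||g' h' gh'] ne Sp'.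
  + by apply: (meet_outer av bv ab E _ Sp' Sp) => e; apply: ne.
  + by apply: (meet_radial vw ww1 ww2 E _ Sp' Sp) => e; apply: ne.
  + by apply: (inner_arc_rim Sp); exact: tail_far Sp'.
  + by apply: (inner_arc_rim Sp); exact: tail_far Sp'.
  have [t [t01 ep _ _ _]] := corner_segment Sp.
  have [s [s01 ep' _ _ _]] := corner_segment Sp'.
  have [ea eb] := triangle_inj (etrans (esym ep) ep').
  have [|k ek] := inner_meet gh gh' _ t01 s01 erefl erefl ea eb.
    by move=> [eg eh]; apply: ne; rewrite eg eh.
  by exists (corner k); rewrite cornerE -ek.
Qed.

(** * Vertices of the new drawing and the arcs through them *)

Lemma vertexP (z : G) : (exists g, z = corner g) \/ exists2 u, u != v & z = inl u.
Proof.
case: z => [u|g]; last by left; exists (Some g).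
by have [->|uv] := eqVneq u v; [left; exists None|right; exists u].
Qed.

Lemma corner_disc g : rho (gadget_point (corner g)) < r \/
  gadget_point (corner g) = q w1 /\ g = Some T1 \/
  gadget_point (corner g) = q w2 /\ g = Some T2.
Proof.
have [a0 b0 ab] := gadget_coord_triangle g; rewrite cornerE.
have [|[[e1 e2]|[e1 e2]]] := triangle_in_disc a0 b0 ab; first by left.
  right; left; split=> //; apply: gadget_coord_inj.
  by rewrite [LHS]surjective_pairing e2.
right; right; split=> //; apply: gadget_coord_inj.
by rewrite [LHS]surjective_pairing e2.
Qed.

Lemma corner_close g : rho (gadget_point (corner g)) <= r.
Proof.
have [_ _ _ r1 _] := tailP vw1; have [_ _ _ r2 _] := tailP vw2.
by case: (corner_disc g) => [/ltW//|[[-> _]|[-> _]]]; rewrite (r1, r2).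
Qed.

(** Gadget corners lie in the closed disc and are separated by their triangle coordinates; all other
    vertices lie strictly outside and keep their old points. *)
Lemma gadget_point_inj : injective gadget_point.
Proof.
have [pt_inj _ _ _] := drawing.
move=> z z'; case: (vertexP z) => [[g ->]|[u uv ->]].
  case: (vertexP z') => [[h ->]|[u uv ->]] e.
    rewrite !cornerE in e; have [e1 e2] := triangle_inj e.
    congr corner; apply: gadget_coord_inj.
    by rewrite [LHS]surjective_pairing e1 e2 -surjective_pairing.
  by have := far_vertex uv; rewrite ltNge -[pt u]e corner_close.
case: (vertexP z') => [[h ->]|[u' uv' ->]] e.
  by have := far_vertex uv; rewrite ltNge [pt u]e corner_close.
by congr inl; exact: pt_inj.
Qed.

Lemma gadget_arc_vertex x y S z : gadget_arc x y S -> S (gadget_point z) ->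
  z = x \/ z = y.
Proof.
have [pt_inj _ on_edge _] := drawing.
have tail_vertex w u : adj v w -> u != v -> tail w (pt u) -> u = w.
  move=> vw uv /(tail_edge vw)/(on_edge _ _ (mem_edges vw)).
  by rewrite in_set2 (negbTE uv) => /eqP.
have tail_corner w g : adj v w -> tail w (gadget_point (corner g)) ->
    w = w1 /\ g = Some T1 \/ w = w2 /\ g = Some T2.
  move=> vw tg; have e := tail_disc vw tg (corner_close g).
  have := corner_disc g; rewrite ltNge (tail_far vw tg) /= => -[//|].
  by rewrite e => -[[/exit_inj e1 ->]|[/exit_inj e1 ->]]; [left|right]; rewrite e1.
case=> [a b av bv ab|w vw ww1 ww2|||g h gh] Sz.
- case: (vertexP z) Sz => [[g ->]|[u uv ->]] Sz.
    by have := outer_arc_far av bv ab Sz; rewrite ltNge corner_close.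
  have := on_edge _ _ (mem_edges ab) Sz.
  by rewrite in_set2 => /orP[]/eqP->; [left|right].
- case: (vertexP z) Sz => [[g ->]|[u uv ->]] Sz; last first.
    right; congr inl; case: Sz => Sz; last exact: tail_vertex Sz.
    by have := far_vertex uv; rewrite ltNge (radial_close vw Sz).
  case: Sz => [[t /andP[t0 _]]|tg].
    have [a0 b0 _] := gadget_coord_triangle g.
    rewrite cornerE => /(triangle_cone vw ww1 ww2 a0 b0 t0)[e1 e2].
    left; rewrite (_ : g = None) //; apply: gadget_coord_inj.
    by rewrite [LHS]surjective_pairing e1 e2.
  by have [[e _]|[e _]] := tail_corner _ _ vw tg; move: ww1 ww2; rewrite e eqxx.
- case: (vertexP z) Sz => [[g ->]|[u uv ->]] Sz.
    have [[_ ->]|[e _]] := tail_corner _ _ vw1 Sz; first by left.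
    by move: w12; rewrite e eqxx.
  by right; congr inl; exact: tail_vertex Sz.
- case: (vertexP z) Sz => [[g ->]|[u uv ->]] Sz.
    have [[e _]|[_ ->]] := tail_corner _ _ vw2 Sz; last by left.
    by move: w12; rewrite e eqxx.
  by right; congr inl; exact: tail_vertex Sz.
- case: (vertexP z) Sz => [[k ->]|[u uv ->]] Sz; last first.
    by have := far_vertex uv; rewrite ltNge (inner_arc_close Sz).
  have [t [t01 e _ _ _]] := corner_segment Sz.
  rewrite cornerE in e; have [e1 e2] := triangle_inj e.
  by have [->|->] := inner_vertex gh t01 e1 e2; [left|right].
Qed.

Lemma gadget_arc_plane x y S : gadget_arc x y S ->
  plane_arc (gadget_point x) (gadget_point y) S.
Proof.
have [pt_inj edge_arc _ _] := drawing.
case=> [a b av bv ab|w vw ww1 ww2|||g h gh].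
- exact: edge_arc.
- have [arc _ qw rq _] := tailP vw.
  apply: (plane_arc_concat _ arc).
    apply: plane_arc_segment; apply: contraTneq r_gt0 => e.
    by rewrite -rq -[q w]e /rho dist2_self ltxx.
  by move=> z /(radial_close vw) zr /(tail_disc vw); apply.
- have -> : gadget_point (inr T1) = q w1.
    by rewrite /= /tri !mul1r !mul0r !addr0 !subrKC -surjective_pairing.
  by have [] := tailP vw1.
- have -> : gadget_point (inr T2) = q w2.
    by rewrite /= /tri !mul1r !mul0r !addr0 !subrKC -surjective_pairing.
  by have [] := tailP vw2.
- apply: plane_arc_segment; apply/eqP => /gadget_point_inj/corner_inj e.
  by move: gh; rewrite e; case: h {e} => [[]|].
Qed.

Lemma gadget_arc_exists (x y : G) : adj x y ->
  exists S, gadget_arc x y S \/ gadget_arc y x S.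
Proof.
have inner g h : inner_edge g h || inner_edge h g ->
    exists S, gadget_arc (corner g) (corner h) S \/ gadget_arc (corner h) (corner g) S.
  by case/orP=> gh; [eexists; left; exact: InnerArc gh|eexists; right; exact: InnerArc gh].
case: x y => [a|g] [b|h] /=.
- rewrite /kept /moved; have [->|av] := eqVneq a v.
    case/andP=> vb; rewrite /= (negbTE (adj_neq vb)) /= orbF negb_or => /andP[b1 b2].
    by eexists; left; exact: RadialArc.
  have [->|bv] := eqVneq b v.
    rewrite adj_sym => /andP[va] /=; rewrite negb_or => /andP[a1 a2].
    by eexists; right; exact: RadialArc.
  by case/andP=> ab _; eexists; left; exact: OuterArc.
- case: h => //= /eqP->.
  + by eexists; right; exact: TailArc1.
  + by eexists; right; exact: TailArc2.
  + exact: (inner None (Some S2)).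
  + exact: (inner None (Some S3)).
- case: g => //= /eqP->.
  + by eexists; left; exact: TailArc1.
  + by eexists; left; exact: TailArc2.
  + exact: (inner (Some S2) None).
  + exact: (inner (Some S3) None).
- move=> gh; apply: (inner (Some g) (Some h)).
  by case: g gh; case: h.
Qed.

Lemma gadget_graph_planar_of_tails : planar R G.
Proof.
apply: (@planar_of_arcs _ _ gadget_point gadget_arc).
- exact: gadget_point_inj.
- exact: gadget_arc_exists.
- exact: gadget_arc_plane.
- exact: gadget_arc_vertex.
- exact: gadget_arc_meet.
Qed.

End Drawing.

Lemma gadget_graph_planar (R : realType) (H : sgraph) (v : H) :
  planar R H -> 3 <= degree v ->
  exists w1 w2, [/\ w1 != w2, adj v w1, adj v w2 & planar R (gadget_graph v w1 w2)].
Proof.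
case=> pt [A drawing] deg3.
have [pt_inj edge_arc _ _] := drawing.
have [r r0 [far_vertex far_edge]] := exists_radius v drawing.
have adjv w : adj v w -> w != v.
  by apply: contraTneq => ->; rewrite adj_irrefl.
(* Exit point and tail are chosen together for each neighbour; other vertices receive the dummy
   value of the origin and the empty set. *)
have /boolp.choice[q' q'P] : forall w, exists mB : (R * R) * set (R * R), adj v w ->
    [/\ plane_arc mB.1 (pt w) mB.2, (mB.2 `<=` A [set v; w]%SET)%classic, mB.2 mB.1,
        dist2 (pt v) mB.1 = r & forall z, mB.2 z -> z = mB.1 \/ (r < dist2 (pt v) z)%R].
  move=> w; have [vw|nvw] := boolP (adj v w); last by exists (0%R, 0%R, set0).
  have [||m [B [? ? ? ? ?]]] := plane_arc_tail (@dist2_continuous R (pt v))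
    (edge_arc _ _ vw) (r := r).
  - by rewrite dist2_self.
  - exact/far_vertex/adjv.
  by exists (m, B).
pose dot w w' := (((q' w).1.1 - (pt v).1) * ((q' w').1.1 - (pt v).1)
  + ((q' w).1.2 - (pt v).2) * ((q' w').1.2 - (pt v).2))%R.
pose P := [pred p : H * H | [&& adj v p.1, adj v p.2 & p.1 != p.2]].
have nbr2 : exists p, P p.
  have : 1 < #|neighbours v| by rewrite -degree_neighbours ltnW.
  case/card_gt1P => a [b []]; rewrite !inE => va vb ab.
  by exists (a, b); apply/and3P.
have [p0 Pp0] := nbr2.
(* The pair is dictated by the drawing: it maximizes the inner product of exit directions. *)
have [[w1 w2] /= /and3P[/= vw1 vw2 w12] wmax] :=
  @Order.TotalTheory.arg_maxP _ _ _ p0 P (fun p => dot p.1 p.2) Pp0.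
(* A third direction bounds the maximal inner product below by -[r]/2, which keeps the triangle
   nondegenerate. *)
have [w3 vw3 /andP[w31 w32]] : exists2 w3, adj v w3 & (w3 != w1) && (w3 != w2).
  have : 0 < #|neighbours v :\ w1 :\ w2|.
    move: deg3; rewrite degree_neighbours.
    by rewrite (cardsD1 w1) (cardsD1 w2 (_ :\ _)) !inE vw1 vw2 eq_sym w12.
  by case/card_gt0P=> w3; rewrite !inE => /and3P[? ? ?]; exists w3 => //; apply/andP.
exists w1, w2; split=> //.
apply: (gadget_graph_planar_of_tails (q := fun w => (q' w).1)
  (tail := fun w => (q' w).2) drawing r0 far_vertex far_edge q'P vw1 vw2 vw3) => //.
by move=> w w' vw vw' ww'; apply: (wmax (w, w')); apply/and3P.
Qed.

(** * Strengthening weak labelings *)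

Section Strengthening.
Variable R : realType.

Definition every_weak := forall (H : sgraph) (N : {set H}),
  k_connected 3 H -> planar R H -> ~~ odd #|N| ->
  exists c : {set H} -> label, weak_labeling N c.

(** Induction on the number of odd negative vertices still to be treated, for all graphs at once,
    since each step enlarges the graph by a gadget. *)
Lemma weak_strong_on (weak : every_weak) n (H : sgraph) (N D : {set H}) :
  #|D| = n -> D \subset N -> (forall u, u \in D -> odd (degree u)) ->
  k_connected 3 H -> planar R H -> ~~ odd #|N| ->
  exists2 c : {set H} -> label, weak_labeling N c &
    forall u, u \in D -> label_degree c lab0 u < degree u.
Proof.
elim: n H N D => [|n IHn] H N D cardD DN Dodd H3 Hp evenN.
  have [c wc] := weak H N H3 Hp evenN; exists c => // u.
  by move/eqP: cardD; rewrite cards_eq0 => /eqP->; rewrite inE.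
have /card_gt0P[v vD] : 0 < #|D| by rewrite cardD.
have vN : v \in N by apply: (fintype.subsetP DN).
have [w1 [w2 [w12 vw1 vw2 Gp]]] := gadget_graph_planar Hp (k_connected_degree v H3).
have G3 := gadget_graph_connected w12 vw1 vw2 H3.
pose D' := inl @: (D :\ v) : {set gadget_graph v w1 w2}.
have inl_inj : injective (inl : H -> gadget_graph v w1 w2) by move=> ? ? [].
have [||||c wc cD'] := IHn _ (gadget_negative v w1 w2 N) D' _ _ _ G3 Gp.
- by rewrite card_imset //; move: cardD; rewrite (cardsD1 v) vD => -[].
- apply/fintype.subsetP => _ /imsetP[u + ->]; rewrite !inE => /andP[uv uD].
  by rewrite uv (fintype.subsetP DN).
- move=> _ /imsetP[u + ->]; rewrite !inE => /andP[uv uD].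
  (* [degree_neq] takes a labeling as an argument although its statement is about degrees alone; a
     constant one is supplied. *)
  by rewrite -(degree_neq w12 vw1 vw2 (fun=> lab0)) // Dodd.
- by rewrite odd_gadget_negative.
exists (contracted_labeling c).
  exact: (contracted_labeling_weak w12 vw1 vw2 wc vN (Dodd v vD)).
move=> u uD; have [->|uv] := eqVneq u v.
  by have [] := contracted_labeling_at_v w12 vw1 vw2 wc vN (Dodd _ vD).
rewrite contracted_degree_neq // (degree_neq w12 vw1 vw2 c) //.
by apply: cD'; apply: imset_f; rewrite !inE uv.
Qed.

End Strengthening.

Theorem theorem2 (R : realType) :
  (forall (H : sgraph) (N : {set H}),
     k_connected 3 H -> planar R H -> ~~ odd #|N| ->
     exists c : {set H} -> label, weak_labeling N c)
  <->
  (forall (H : sgraph) (N : {set H}),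
     k_connected 3 H -> planar R H -> ~~ odd #|N| ->
     exists c : {set H} -> label, strong_labeling N c).
Proof.
split=> [weak|strong] H N H3 Hp evenN; last first.
  by have [c []] := strong H N H3 Hp evenN; exists c.
pose D := [set u in N | odd (degree u)].
have [||c wc cD] := weak_strong_on weak (erefl #|D|) _ _ H3 Hp evenN.
- by apply/fintype.subsetP => u; rewrite inE => /andP[].
- by move=> u; rewrite inE => /andP[].
exists c; split=> // u du; have [uN|uN] := boolP (u \in N).
  by apply: cD; rewrite inE uN.
(* At a positive vertex of odd degree [laba] occurs an odd number of times, so some edge is not
   labeled [lab0]. *)
have /weak_labelingP/(_ u)[_ + _] := wc.
rewrite du (negbTE uN) /= => /odd_gt0 la_gt0.
by rewrite (degree_labels c) -addnA -{1}[label_degree c lab0 u]addn0 ltn_add2l ltn_addr.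
Qed.
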